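(* Let $n\ge1$, $0<p<\infty$, $0<q\le\infty$, and let $u\in\Xi_{p,q}^n$ be such that $u(r)\asymp u(2r)$ for $r>0$. Additionally, if $0<p<2$, assume that $r^{\frac np-\frac n2}u(r)\in\Xi_{2,q}^n$. Let $f\in L_1(\mathbb R^n)$ and suppose that $$D_{p,q}^u(f):=\bigg(\sum_{m\in\mathbb Z}\bigg(\sup_{e\subset\mathbb Z^n}\frac{(1+\ln|e|)^{n+1}}{|e|^{\frac1p-\max\{0,\frac1p-\frac12\}}}\cdot\frac{u(2^{-m})}{(2^{mn})^{1/p}}\int_{\bigcup_{k\in e}Q_k^m}|f(x)|\,dx\bigg)^q\bigg)^{1/q}<\infty$$ (with the usual modification, $\sup_{m\in\mathbb Z}$ in place of the $\ell_q$-sum, if $q=\infty$). Then $\widehat f\in M_{p,q}^u$, and moreover $$\|\widehat f\|_{M_{p,q}^u}\lesssim D_{p,q}^u(f),$$ with a constant independent of $f$.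
   Context: The Fourier transform of $f\in L_1(\mathbb R^n)$ is $\widehat f(y)=\int_{\mathbb R^n}f(x)e^{-2\pi i(x,y)}\,dx$. For $k\in\mathbb Z^n$, $m\in\mathbb Z$, $Q_k^m=[0,2^m)^n+2^mk$. The supremum is over finite nonempty sets $e\subset\mathbb Z^n$, and $|e|$ denotes the cardinality of $e$. For $0<p<\infty$, $0<q\le\infty$, $d>0$, $\Xi_{p,q}^d$ is the class of nonnegative weight functions $u$ on $(0,\infty)$ such that for every fixed $\varepsilon>0$, $\|r^{\frac dp-\frac1q}u(r)\|_{L_q(0,\varepsilon)}<\infty$ and $\|r^{-\frac1q}u(r)\|_{L_q(\varepsilon,\infty)}<\infty$. The weighted Morrey-type space $M_{p,q}^u=M_{p,q}^u(\mathbb R^n)$ consists of $g\in L_p^{\mathrm{loc}}(\mathbb R^n)$ with finite (quasi-)norm $\|g\|_{M_{p,q}^u}=\big(\int_0^\infty(u(r)\sup_{x\in\mathbb R^n}\|g\|_{L_p(B_r(x))})^q\frac{dr}r\big)^{1/q}$ if $q<\infty$, and $\|g\|_{M_{p,\infty}^u}=\sup_{r>0}u(r)\sup_{x\in\mathbb R^n}\|g\|_{L_p(B_r(x))}$ if $q=\infty$; here $B_r(x)$ is the ball of radius $r$ centered at $x$. $A\lesssim B$ means $A\le CB$ with a constant $C$ not depending on essential quantities, and $A\asymp B$ means $A\lesssim B$ and $B\lesssim A$; in $u(r)\asymp u(2r)$ the constants are independent of $r$.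
   Formalization: The condition u(r) ≍ u(2r) is strengthened to u(r) ≍ u(s) for all r ≤ s ≤ 2r, with constants independent of r and s; with only the endpoint condition the claim fails, e.g. for u = 0 at all powers of 2 and u(r) = r^(-1/4) elsewhere (n=1, p=q=2). *)

(* Defs.v *)
From HB Require Import structures.
From mathcomp Require Import all_boot all_order all_algebra finmap.
From mathcomp Require Import complex.
From mathcomp Require Import all_classical all_reals all_analysis.
Set Implicit Arguments.
Unset Strict Implicit.
Unset Printing Implicit Defensive.
Import Order.TTheory GRing.Theory Num.Theory.
Import numFieldNormedType.Exports.
Local Open Scope classical_set_scope.
Local Open Scope ring_scope.

(* Points of R^n are n-tuples, with the product of the Borel sigma-algebras
   that the library puts on them. Lebesgue measure on R^n is the n-fold product
   of the one-dimensional Lebesgue measure, transported along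
   (a, x) |-> a :: x. *)

Definition tuple_cons (T : Type) (n : nat) (z : T * n.-tuple T) :
  n.+1.-tuple T := [tuple of z.1 :: z.2].

Definition lebesgue_cons (R : realType) (n : nat)
    (m : set (n.-tuple R) -> \bar R) : set (n.+1.-tuple R) -> \bar R :=
  pushforward (@lebesgue_measure R \x m)%E (@tuple_cons R n).

Fixpoint lebesgue_tuple (R : realType) (n : nat) :
    set (n.-tuple R) -> \bar R :=
  match n with
  | 0 => \d_[tuple]
  | n'.+1 => lebesgue_cons (@lebesgue_tuple R n')
  end.
Arguments lebesgue_tuple : clear implicits.

Lemma measurable_tuple_cons d (T : measurableType d) n :
  measurable_fun [set: T * n.-tuple T] (@tuple_cons T n).
Proof. exact: measurable_cons. Qed.

Section lebesgue_cons_measure.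
Variables (R : realType) (n : nat).
Variable m : {sigma_finite_measure set (n.-tuple R) -> \bar R}.
Local Notation prod_m := (@lebesgue_measure R \x m)%E.
Local Notation P := (lebesgue_cons m).

Let mcons : measurable_fun [set: measurableTypeR R * n.-tuple R]
  (@tuple_cons R n).
Proof. exact: measurable_tuple_cons. Qed.

Let P0 : P set0 = 0%E.
Proof. by rewrite /lebesgue_cons /pushforward preimage_set0 measure0. Qed.

Let P_ge0 A : (0 <= P A)%E.
Proof. exact: measure_ge0. Qed.

Let P_sigma_additive : semi_sigma_additive P.
Proof.
move=> F mF tF mUF; rewrite /lebesgue_cons /pushforward preimage_bigcup.
apply: measure_semi_sigma_additive.
- by move=> i; rewrite -[X in measurable X]setTI; exact: mcons.
- apply/trivIsetP => /= i j _ _ ij; rewrite -preimage_setI.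
  by move/trivIsetP : tF => /(_ _ _ _ _ ij) ->//; rewrite preimage_set0.
- by rewrite -preimage_bigcup -[X in measurable X]setTI; exact: mcons.
Qed.

HB.instance Definition _ := isMeasure.Build _ _ _ P P0 P_ge0 P_sigma_additive.

Let P_sigma_finite : sigma_finite [set: n.+1.-tuple R] P.
Proof.
have /sigma_finiteP[F [TF ndF Foo]] := sigma_finiteT (@lebesgue_measure R).
have /sigma_finiteP[G [TG ndG Goo]] := sigma_finiteT m.
pose g (x : n.+1.-tuple R) : n.-tuple R := [tuple of behead x].
exists (fun i => (fun x => thead x) @^-1` F i `&` g @^-1` G i).
  apply/esym; rewrite -subTset => x _.
  have [i _ Fi] : (\bigcup_i F i) (thead x) by rewrite -TF.
  have [j _ Gj] : (\bigcup_i G i) (g x) by rewrite -TG.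
  exists (maxn i j) => //; split.
  - by apply: (subsetPset _ _ (ndF _ _ (leq_maxl i j))) Fi.
  - by apply: (subsetPset _ _ (ndG _ _ (leq_maxr i j))) Gj.
move=> i; have [mFi Fi] := Foo i; have [mGi Gi] := Goo i; split.
  apply: measurableI; rewrite -[X in measurable X]setTI.
    exact: (measurable_tnth ord0).
  exact: measurable_behead.
rewrite [ltLHS](_ : _ = prod_m (F i `*` G i)); last first.
  rewrite /lebesgue_cons /pushforward; congr product_measure1.
  apply/seteqP; split=> -[a x] /=; rewrite /tuple_cons theadE /=.
    by move=> [? ?]; split => //; rewrite (_ : x = g [tuple of a :: x])//;
      exact/val_inj.
  by move=> [? ?]; split => //; rewrite (_ : g _ = x)//; exact/val_inj.
by rewrite product_measure1E// lte_mul_pinfty// ge0_fin_numE.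
Qed.

HB.instance Definition _ := Measure_isSigmaFinite.Build _ _ _ P P_sigma_finite.

End lebesgue_cons_measure.

Lemma lebesgue_tuple_measure (R : realType) (n : nat) :
  { m : {sigma_finite_measure set (n.-tuple R) -> \bar R} |
    (m : set (n.-tuple R) -> \bar R) = lebesgue_tuple R n }.
Proof.
elim: n => [|n [m mE]]; first by exists \d_[tuple].
by exists (lebesgue_cons m); rewrite /= -mE.
Qed.

Section lebesgue_tuple_instance.
Variables (R : realType) (n : nat).
Local Notation mu := (lebesgue_tuple R n).

Let mu0 : mu set0 = 0%E.
Proof. by have [m <-] := lebesgue_tuple_measure R n; exact: measure0. Qed.

Let mu_ge0 A : (0 <= mu A)%E.
Proof. by have [m <-] := lebesgue_tuple_measure R n; exact: measure_ge0. Qed.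

Let mu_sigma_additive : semi_sigma_additive mu.
Proof.
have [m <-] := lebesgue_tuple_measure R n.
exact: measure_semi_sigma_additive.
Qed.

HB.instance Definition _ := isMeasure.Build _ _ _ mu
  mu0 mu_ge0 mu_sigma_additive.

Let mu_sigma_finite : sigma_finite setT mu.
Proof. by have [m <-] := lebesgue_tuple_measure R n; exact: sigma_finiteT. Qed.

HB.instance Definition _ := Measure_isSigmaFinite.Build _ _ _ mu
  mu_sigma_finite.

End lebesgue_tuple_instance.

Section euclidean.
Variables (R : realType) (n : nat).
Implicit Types x y : n.-tuple R.

Definition dotp x y : R := \sum_(i < n) tnth x i * tnth y i.

Definition eball x (r : R) : set (n.-tuple R) :=
  [set y | Num.sqrt (\sum_(i < n) (tnth y i - tnth x i) ^+ 2) < r].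

(* the dyadic cube [0, 2^m)^n + 2^m k *)
Definition dyadic_cube (m : int) (k : n.-tuple int) : set (n.-tuple R) :=
  [set x | forall i, 0 <= tnth x i - 2 ^ m * (tnth k i)%:~R < 2 ^ m].

End euclidean.
Arguments dyadic_cube : clear implicits.

Section complex_valued.
Variable R : realType.

Definition cmod (z : R[i]) : R := Num.sqrt (complex.Re z ^+ 2 + complex.Im z ^+ 2).

Definition cis (t : R) : R[i] := Complex (cos t) (sin t).

Context d (T : measurableType d) (mu : {measure set T -> \bar R}).
Implicit Type f : T -> R[i].

Definition cmeasurable f :=
  measurable_fun [set: T] (fun x => complex.Re (f x)) /\
  measurable_fun [set: T] (fun x => complex.Im (f x)).

Definition cintegrable f :=
  mu.-integrable [set: T] (fun x => (complex.Re (f x))%:E) /\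
  mu.-integrable [set: T] (fun x => (complex.Im (f x))%:E).

Definition cintegral f : R[i] :=
  Complex (\int[mu]_x complex.Re (f x)) (\int[mu]_x complex.Im (f x)).

(* the (quasi-)norm of f in L_p(A), also for 0 < p < 1 *)
Definition cLnorm (p : R) (A : set T) f : \bar R :=
  'N[mu]_p%:E[(fun x => (cmod (f x))%:E) \_ A].

End complex_valued.

Definition fourier (R : realType) (n : nat) (f : n.-tuple R -> R[i]) :
    n.-tuple R -> R[i] :=
  fun y => cintegral (lebesgue_tuple R n)
    (fun x => f x * cis (- (2 * pi * dotp x y))).

Section weights.
Variable R : realType.
Implicit Type u : R -> R.

(* Weights live on (0, oo); their values elsewhere are irrelevant. The
   exponent 1/q is 0 for q = +oo. *)
Definition Xi (d p : R) (q : \bar R) u :=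
  [/\ measurable_fun (`]0, +oo[ : set R) u,
      (forall r, 0 < r -> 0 <= u r) &
      forall eps, 0 < eps ->
        ('N[lebesgue_measure]_q
           [(fun r => (r `^ (d / p - fine q^-1%E) * u r)%:E) \_ `]0%R, eps[]
           < +oo)%E /\
        ('N[lebesgue_measure]_q
           [(fun r => (r `^ (- fine q^-1%E) * u r)%:E) \_ `]eps, +oo[]
           < +oo)%E].

(* u(r) ~ u(2r): u is comparable, uniformly in r > 0, to u(r) throughout
   [r, 2r]. Comparing only the two endpoints r and 2r would leave the
   dyadic values u(2^m) unrelated to the values of u in between. *)
Definition doubling_weight u :=
  exists2 c : R, 0 < c &
    forall r s, 0 < r -> r <= s <= 2 * r -> u r <= c * u s /\ u s <= c * u r.

End weights.

Section morrey.
Variables (R : realType) (n : nat) (p : R) (q : \bar R) (u : R -> R).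
Local Notation mu := (lebesgue_tuple R n).
Local Open Scope ereal_scope.

Definition morrey_norm (g : n.-tuple R -> R[i]) : \bar R :=
  let G r := (u r)%:E * ereal_sup [set cLnorm mu p (eball x r) g | x in setT] in
  if q is q'%:E then
    (\int[lebesgue_measure]_(r in `]0%R, +oo[) (G r `^ q' * (r^-1)%:E)) `^ q'^-1
  else ereal_sup [set G r | r in `]0%R, +oo[].

Definition morrey_space : set (n.-tuple R -> R[i]) :=
  [set g | [/\ cmeasurable g,
               forall x r, cLnorm mu p (eball x r) g < +oo &
               morrey_norm g < +oo]].

Definition dyadic_term (f : n.-tuple R -> R[i]) (m : int) : \bar R :=
  ereal_sup
    [set ((1 + ln #|` e|%:R) ^+ n.+1
            / #|` e|%:R `^ (p^-1 - Num.max 0 (p^-1 - 2^-1))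
          * (u (2 ^ (- m)) / (2 ^ (m * n%:Z)) `^ p^-1))%:E
         * \int[mu]_(x in \bigcup_(k in [set` e]) dyadic_cube R n m k)
             (cmod (f x))%:E
    | e in [set e : {fset n.-tuple int} | e != fset0]].

Definition dyadic_norm (f : n.-tuple R -> R[i]) : \bar R :=
  if q is q'%:E then
    (\esum_(m in [set: int]) dyadic_term f m `^ q') `^ q'^-1
  else ereal_sup (range (dyadic_term f)).

End morrey.

(* Main.v *)
Require Import Defs.
From HB Require Import structures.
From mathcomp Require Import all_boot all_order all_algebra finmap.
From mathcomp Require Import complex.
From mathcomp Require Import all_classical all_reals all_analysis.
From mathcomp Require Import measurable_realfun.
From mathcomp Require Import ring lra zify.
Set Implicit Arguments.
Unset Strict Implicit.
Unset Printing Implicit Defensive.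
Import Order.TTheory GRing.Theory Num.Theory.
Import numFieldNormedType.Exports.
Local Open Scope classical_set_scope.
Local Open Scope ring_scope.

(** Fix a dyadic scale [m], put [P = max(p, 2)] and let [a_k] be the integral of
    [|f|] over the cube [Q_k^m]. On a ball [B] of radius at most [2^-m] the
    exponentials attached to points of one cube hardly vary, and a tent weight
    dominating the indicator of [B] has a Fourier transform decaying
    quadratically in each variable; Schur's test then gives
    [||h^||_{L_2(B)}^2 <= C |B| sum_{k in e} a_k^2] when [h] is the restriction of
    [f] to the cubes [Q_k^m] with [k in e], and trivially [|h^| <= C sum_{k in e} a_k].

    If [S] bounds all [(1 + ln |e|)^(n+1) |e|^(-1/P) sum_{k in e} a_k], split the
    cubes into the level sets [S 2^(-j-1) < a_k <= S 2^-j]. Interpolating the two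
    estimates bounds the [L_P(B)] norm of the [j]-th piece by
    [C |B|^(1/P) S N_j^(1-1/P) 2^-j], where [N_j] is the number of cubes of level
    [j], and the logarithm in the hypothesis makes these numbers summable in [j].
    Hence [||f^||_{L_P(B)} <= C |B|^(1/P) S]; for [p < 2] the [L_p] bound follows from
    the [L_2] bound. Integrating over the shells [2^(-m-1) < r <= 2^-m] gives the
    theorem. *)

(** The constant must not depend on [f], although [f] may charge infinitely many cubes with
    arbitrarily small masses. A finite box of cubes and the number [J] of levels are therefore
    chosen after [f], so large that the transform of the discarded part is at most [S] everywhere;
    this part costs one more term [|B|^(1/P) S]. Uniformity rests on two sums bounded independently
    of the box: the row sums of the lattice kernel and the sum of the level masses.

    A sharp interval indicator has a transform decaying only like [1 / |s|], whose sums over the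
    lattice diverge. The tent is the convolution square of an interval, so its transform is a
    square: nonnegative and of order [1 / s^2]. Side [2^m] and radius [2^-m] are dual, so up to
    constants the resulting kernel depends only on the difference of the cube indices.

    On a level set with [N] masses of size about [M] their sum is about [N M] and their square sum
    about [N M^2], so interpolating on each level loses nothing, and only the sum over the levels
    has to be paid for by the logarithm. *)

Lemma integrable_mul_bounded d (T : measurableType d) (R : realType)
    (mu : {measure set T -> \bar R}) (f h : T -> R) (M : R) :
  mu.-integrable [set: T] (EFin \o f) -> measurable_fun [set: T] h ->
  (forall x, `|h x| <= M) -> mu.-integrable [set: T] (EFin \o (fun x => f x * h x)).
Proof.
move=> intf mh hM.
rewrite (_ : _ \o _ = ((EFin \o f) \* (EFin \o h))%E); last first.
  by apply/funext => x /=; rewrite EFinM.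
apply: integrableMl => //; exists M; split; first exact: num_real.
by move=> N MN x _ /=; rewrite (le_trans (hM x))// ltW.
Qed.

(** * The one-dimensional tent and its Fourier transform *)

Section tent.
Variable R : realType.
Local Notation leb := (@lebesgue_measure R).
Implicit Types a b c d s y : R.

(** The convolution square of the indicator of an interval of length [d], translated to [c]. *)
Definition tent d c y := Num.max 0 (d - `|y - c|).

Lemma tent_ge0 d c y : 0 <= tent d c y.
Proof. by rewrite /tent le_max lexx. Qed.

Lemma continuous_tent d c : continuous (tent d c).
Proof.
move=> y; apply: (@continuous_max R R (cst 0) (fun z => d - `|z - c|)); first exact: cst_continuous.
apply: cvgB; first exact: cvg_cst.
apply: cvg_norm; apply: cvgB; [exact: cvg_id|exact: cvg_cst].
Qed.

Lemma measurable_tent d c : measurable_fun setT (tent d c).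
Proof. exact: continuous_measurable_fun (@continuous_tent d c). Qed.

Lemma tent_out d c y : y \notin `[c - d, c + d] -> tent d c y = 0.
Proof.
rewrite in_itv/= => yN; apply/eqP; rewrite /tent eq_maxl// lerBlDr add0r.
move: yN; rewrite negb_and -!ltNge ler_normr => /orP[|] ?; apply/orP; lra.
Qed.

Lemma integrable_tent d c : leb.-integrable setT (EFin \o tent d c).
Proof.
have -> : tent d c = (tent d c) \_ `[c - d, c + d].
  by apply/funext => y; rewrite patchE mem_setE; case: ifPn => // /tent_out.
rewrite -restrict_EFin; apply/integrable_restrict => //; rewrite setTI; apply: continuous_compact_integrable.
  exact: segment_compact.
by apply: continuous_subspaceT; exact: continuous_tent.
Qed.

Lemma is_derive_continuous (f F : R -> R) :
  (forall x : R, is_derive x (1 : R) F (f x)) -> continuous F.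
Proof.
by move=> dF x; apply/differentiable_continuous/derivable1_diffP; have [] := dF x.
Qed.

Lemma Rintegral_FTC (f F : R -> R) a b : a < b ->
  continuous f -> (forall x : R, is_derive x (1 : R) F (f x)) ->
  \int[leb]_(x in `[a, b]) f x = F b - F a.
Proof.
move=> ab cf dF; rewrite /Rintegral (@continuous_FTC2 _ f F)//.
- exact: continuous_subspaceT.
- have cF := is_derive_continuous dF.
  split; [by move=> x _; have [] := dF x| |].
  + exact/cvg_at_right_filter/cF.
  + exact/cvg_at_left_filter/cF.
- by move=> x _; rewrite derive1E; have [_ ->] := dF x.
Qed.

Lemma is_derive_affine a s x : is_derive x (1 : R) (fun y : R => a + s * y) s.
Proof.
have -> : (fun y : R => a + s * y) = cst a + s \*: id by apply/funext.
by apply: is_derive_eq; rewrite add0r /GRing.scale/= mulr1.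
Qed.

Lemma is_derive_sin_affine a s x :
  is_derive x (1 : R) (fun y : R => sin (a + s * y)) (s * cos (a + s * x)).
Proof.
rewrite mulrC; apply: is_derive1_comp.
exact: is_derive_affine.
Qed.

Lemma is_derive_cos_affine a s x :
  is_derive x (1 : R) (fun y : R => cos (a + s * y)) (- (s * sin (a + s * x))).
Proof.
rewrite mulrC -mulNr; apply: is_derive1_comp.
exact: is_derive_affine.
Qed.

(** The antiderivative that one integration by parts produces. *)
Lemma is_derive_affine_cos a b k s x : s != 0 ->
  is_derive x (1 : R)
    (fun y : R => (b + k * y) * sin (a + s * y) / s + k * cos (a + s * y) / s ^+ 2)
    ((b + k * x) * cos (a + s * x)).
Proof.
move=> s0.
have -> : (fun y : R => (b + k * y) * sin (a + s * y) / s + k * cos (a + s * y) / s ^+ 2)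
  = s^-1 \*: ((fun y => b + k * y) * (fun y : R => sin (a + s * y))) +
     (k / s ^+ 2) \*: (fun y : R => cos (a + s * y)).
  apply/funext => y.
  rewrite -[RHS]/(s^-1 * ((b + k * y) * sin (a + s * y)) + k / s ^+ 2 * cos (a + s * y)).
  by ring.
have := is_derive_affine b k x; have := is_derive_sin_affine a s x.
have := is_derive_cos_affine a s x => d1 d2 d3.
apply: is_derive_eq; rewrite /GRing.scale/=; field.
exact: s0.
Qed.

Lemma is_derive_affine_sqr b k x :
  is_derive x (1 : R) (fun y : R => b * y + k / 2 * y ^+ 2) (b + k * x).
Proof.
have -> : (fun y : R => b * y + k / 2 * y ^+ 2) = b \*: id + (k / 2) \*: (id ^+ 2) by [].
by apply: is_derive_eq; rewrite /GRing.scale/=; field.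
Qed.

Lemma continuous_affine_cos a b k s :
  continuous (fun y : R => (b + k * y) * cos (a + s * y)).
Proof.
by move=> x; apply: cvgM; [exact: (is_derive_continuous (is_derive_affine b k))|
  exact: (is_derive_continuous (is_derive_cos_affine a s))].
Qed.

(** Cutting at the peak [c] leaves an affine factor on each half; both are written as [b + k * y] to
    match the antiderivatives above. *)
Lemma Rintegral_tentM d c (g : R -> R) : 0 < d -> continuous g ->
  \int[leb]_y (tent d c y * g y) =
  \int[leb]_(y in `[c - d, c]) ((d - c + 1 * y) * g y) +
  \int[leb]_(y in `[c, c + d]) ((d + c + -1 * y) * g y).
Proof.
move=> d0 cg.
have cd : c - d <= c by lra.
have dc : c <= c + d by lra.
have cf : continuous (fun y => tent d c y * g y).
  by move=> y; apply: cvgM; [exact: continuous_tent|exact: cg].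
have itf (x y : R) : leb.-integrable `[x, y] (EFin \o (fun y => tent d c y * g y)).
  apply: continuous_compact_integrable; first exact: segment_compact.
  exact: continuous_subspaceT.
transitivity (\int[leb]_(y in `[c - d, c + d]) (tent d c y * g y)).
  rewrite [RHS]Rintegral_mkcond; apply: eq_Rintegral => y _.
  by rewrite patchE mem_setE; case: ifPn => // /tent_out ->; rewrite mul0r.
have -> : `[c - d, c + d]%classic = `[c - d, c]%classic `|` `]c, c + d]%classic.
  apply/seteqP; split => y /=; rewrite !in_itv/=.
    by move=> /andP[-> ->]; case: (leP y c) => _; [left|right].
  by case=> /andP[? ?]; apply/andP; split; lra.
rewrite Rintegral_setU//.
- rewrite Rintegral_itv_obnd_cbnd; last first.
    by apply: integrableS (itf c (c + d)) => //; exact: subset_itv_oc_cc.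
  congr (_ + _); apply: eq_Rintegral => y; rewrite inE/= in_itv/= => /andP[y1 y2].
    rewrite /tent ler0_norm ?subr_le0// (elimT max_idPr); last by lra.
    by congr (_ * _); ring.
  rewrite /tent ger0_norm ?subr_ge0// (elimT max_idPr); last by lra.
  by congr (_ * _); ring.
- apply: integrableS (itf (c - d) (c + d)) => //; first exact: measurableU.
  by move=> y /=; rewrite !in_itv/= => -[] /andP[? ?]; apply/andP; split; lra.
- apply/disj_setPS => y [] /=; rewrite !in_itv/= => /andP[_ yc] /andP[cy _].
  by move: (lt_le_trans cy yc); rewrite ltxx.
Qed.

(** The Fejer kernel [(2 sin (s d / 2) / s)^2], with its limit [d^2] at [s = 0], where the quotient
    would evaluate to 0. *)
Definition tent_hat d s := if s == 0 then d ^+ 2 else 2 * (1 - cos (s * d)) / s ^+ 2.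

(** The tent is even about [c], so the sine component integrates to 0. The free phase [a] serves the
    induction on the dimension: the other coordinates enter through it. *)
Lemma Rintegral_tent_cos d c a s : 0 < d ->
  \int[leb]_y (tent d c y * cos (a + s * y)) = cos (a + s * c) * tent_hat d s.
Proof.
move=> d0; rewrite /tent_hat; have [->|s0] := eqVneq s 0.
  under eq_Rintegral do rewrite mul0r addr0.
  rewrite mul0r addr0 (@Rintegral_tentM d c (cst (cos a)))//; last exact: cst_continuous.
  have ia (x y b k : R) : x < y -> \int[leb]_(z in `[x, y]) ((b + k * z) * cos a) =
    ((b * y + k / 2 * y ^+ 2) - (b * x + k / 2 * x ^+ 2)) * cos a.
    move=> xy; rewrite RintegralZr//; last first.
      apply: continuous_compact_integrable; first exact: segment_compact.
      exact/continuous_subspaceT/(is_derive_continuous (is_derive_affine b k)).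
    rewrite (Rintegral_FTC xy _ (is_derive_affine_sqr b k))//.
    exact: is_derive_continuous (is_derive_affine b k).
  rewrite !ia; [|lra|lra].
  by field.
rewrite Rintegral_tentM//; last first.
  exact: is_derive_continuous (is_derive_cos_affine a s).
rewrite !(Rintegral_FTC _ (@continuous_affine_cos _ _ _ _)
  (fun x => is_derive_affine_cos _ _ _ _ s0)); [|lra|lra].
have -> : a + s * (c - d) = (a + s * c) - s * d by ring.
have -> : a + s * (c + d) = (a + s * c) + s * d by ring.
rewrite !(cosD, sinD, cosN, sinN); field.
exact: s0.
Qed.

Lemma tent_hat_ge0 d s : 0 <= tent_hat d s.
Proof.
rewrite /tent_hat; case: ifPn => _; first exact: sqr_ge0.
by rewrite mulr_ge0// ?invr_ge0 ?sqr_ge0// mulr_ge0// subr_ge0 cos_le1.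
Qed.

(** The sum of two bounds: [tent_hat d s <= d^2], because [cos <= 1] makes the frequency 0 extremal,
    and [d^2 s^2 tent_hat d s <= 4 d^2] from the closed form; [5 = 1 + 4]. *)
Lemma tent_hat_le d s : 0 < d -> tent_hat d s <= 5 * d ^+ 2 / (1 + (d * s) ^+ 2).
Proof.
move=> d0; have le1 : tent_hat d s <= d ^+ 2.
  have -> : d ^+ 2 = tent_hat d 0 by rewrite /tent_hat eqxx.
  have := Rintegral_tent_cos 0 0 s d0; have := Rintegral_tent_cos 0 0 0 d0.
  rewrite !mulr0 addr0 cos0 !mul1r => <- <-.
  under [leLHS]eq_Rintegral do rewrite add0r.
  under [leRHS]eq_Rintegral do rewrite add0r mul0r cos0 mulr1.
  apply: le_Rintegral => //; last 2 first.
  - exact: integrable_tent.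
  - by move=> y _; rewrite ler_piMr ?tent_ge0// cos_le1.
  apply: (integrable_mul_bounded (M := 1)); first exact: integrable_tent.
    apply: continuous_measurable_fun => y.
    apply: (@continuous_comp _ _ _ (fun y => s * y) cos); last exact: continuous_cos.
    exact: mulrl_continuous.
  by move=> y; exact: cos_max.
have le2 : tent_hat d s * s ^+ 2 <= 4.
  rewrite /tent_hat; have [->|s0] := eqVneq s 0; first by rewrite expr0n mulr0.
  rewrite divfK ?sqrf_eq0//; have := cos_geN1 (s * d); lra.
rewrite ler_pdivlMr; last by rewrite ltr_pwDl// sqr_ge0.
rewrite exprMn mulrDr mulr1.
have : tent_hat d s * (d ^+ 2 * s ^+ 2) <= 4 * d ^+ 2.
  by rewrite mulrCA (mulrC 4) ler_wpM2l// sqr_ge0.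
lra.
Qed.

End tent.

(** * Fubini for two integrable factors and a bounded kernel *)

Section fubini_kernel.
Context d1 d2 (T1 : measurableType d1) (T2 : measurableType d2) (R : realType).
Variable m1 : {sigma_finite_measure set T1 -> \bar R}.
Variable m2 : {sigma_finite_measure set T2 -> \bar R}.

Lemma measurable_integral_kernel (h : T1 * T2 -> R) :
  measurable_fun [set: T1 * T2] h ->
  measurable_fun [set: T1] (fun x => \int[m2]_y h (x, y)).
Proof.
move=> mh; have mEh : measurable_fun [set: T1 * T2] (EFin \o h) by exact/measurable_EFinP.
apply: (@measurableT_comp _ _ _ _ _ _ fine) => //.
rewrite (_ : (fun x => _) = (fun x => \int[m2]_y (funepos (EFin \o h)) (x, y) -
   \int[m2]_y (funeneg (EFin \o h)) (x, y))%E); last first.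
  apply/funext => x; rewrite -[LHS]/(\int[m2]_y ((EFin \o h) \o pair x) y)%E [LHS]integralE.
  by rewrite funepos_comp funeneg_comp.
apply: emeasurable_funB.
- apply: (@measurable_fun_fubini_tonelli_F _ _ _ _ _ m2 ((funepos (EFin \o h)))) => //.
  exact: measurable_funepos.
- apply: (@measurable_fun_fubini_tonelli_F _ _ _ _ _ m2 ((funeneg (EFin \o h)))) => //.
  exact: measurable_funeneg.
Qed.

Variables (f : T1 -> R) (g : T2 -> R).
Hypothesis intf : m1.-integrable [set: T1] (EFin \o f).
Hypothesis intg : m2.-integrable [set: T2] (EFin \o g).

Lemma measurable_prod_mul : measurable_fun [set: T1 * T2] (fun z => f z.1 * g z.2).
Proof.
apply: measurable_funM; apply: measurableT_comp => //.
- by move/integrableP : intf => [/measurable_EFinP].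
- by move/integrableP : intg => [/measurable_EFinP].
Qed.

Lemma integrable_prod_mul :
  (m1 \x m2)%E.-integrable [set: T1 * T2] (EFin \o (fun z => f z.1 * g z.2)).
Proof.
have mfg : measurable_fun [set: T1 * T2] (EFin \o (fun z => f z.1 * g z.2)).
  by apply/measurable_EFinP; exact: measurable_prod_mul.
apply: (integrable12ltyP _ _ mfg).2.
rewrite (eq_integral (fun x => `|(f x)%:E| * \int[m2]_y `|(g y)%:E|)%E); last first.
  move=> x _; rewrite -ge0_integralZl//; first by apply: eq_integral => y _; rewrite /= normrM.
  by apply: measurableT_comp => //; move/integrableP : intg => [].
have [mEg gy] := integrableP _ _ _ intg; have [mEf fy] := integrableP _ _ _ intf.
rewrite ge0_integralZr//; first by rewrite lte_mul_pinfty// ?integral_ge0// ge0_fin_numE// integral_ge0.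
- exact: measurableT_comp.
- exact: integral_ge0.
Qed.

Variables (k : T1 * T2 -> R) (M : R).
Hypothesis mk : measurable_fun [set: T1 * T2] k.
Hypothesis kM : forall z, `|k z| <= M.

Lemma integrable_fubini_kernel :
  (m1 \x m2)%E.-integrable [set: T1 * T2] (EFin \o (fun z => f z.1 * g z.2 * k z)).
Proof. exact: integrable_mul_bounded integrable_prod_mul mk kM. Qed.

Let itx x : m2.-integrable [set: T2] (EFin \o (fun y => g y * k (x, y))).
Proof.
apply: integrable_mul_bounded intg _ (fun y => kM (x, y)).
exact: measurableT_comp.
Qed.

Let ity y : m1.-integrable [set: T1] (EFin \o (fun x => f x * k (x, y))).
Proof.
apply: integrable_mul_bounded intf _ (fun x => kM (x, y)).
exact: measurableT_comp.
Qed.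

Lemma Rintegral_prod_kernel1 :
  \int[(m1 \x m2)%E]_z (f z.1 * g z.2 * k z) = \int[m1]_x (f x * \int[m2]_y (g y * k (x, y))).
Proof.
rewrite /Rintegral -(integral12_prod_meas1 integrable_fubini_kernel).
congr fine; apply: eq_integral => x _; rewrite EFinM (fineK (integrable_fin_num measurableT (itx x))).
rewrite -integralZl//; apply: eq_integral => y _ /=.
by rewrite -EFinM mulrA.
Qed.

Lemma Rintegral_prod_kernel2 :
  \int[(m1 \x m2)%E]_z (f z.1 * g z.2 * k z) = \int[m2]_y (g y * \int[m1]_x (f x * k (x, y))).
Proof.
rewrite /Rintegral -(integral21_prod_meas1 integrable_fubini_kernel).
congr fine; apply: eq_integral => y _; rewrite EFinM (fineK (integrable_fin_num measurableT (ity y))).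
rewrite -integralZl//; apply: eq_integral => x _ /=.
by rewrite -EFinM mulrA (mulrC (g y)).
Qed.

(** Boundedness of [k] makes [f(x) g(y) k(x, y)] integrable on the product. The energy identity uses
    this exchange twice, with a cosine and with an integral of cosines as kernel. *)
Lemma Rfubini : \int[m1]_x (f x * \int[m2]_y (g y * k (x, y))) =
  \int[m2]_y (g y * \int[m1]_x (f x * k (x, y))).
Proof. by rewrite -Rintegral_prod_kernel1 Rintegral_prod_kernel2. Qed.

End fubini_kernel.

(** * Product tents on R^n and their Fourier transforms *)

Section lebesgue_tuple_cons.
Variables (R : realType) (n : nat).
Local Notation leb := (@lebesgue_measure R).
Local Notation mu m := (lebesgue_tuple R m).

Let mcons : measurable_fun [set: measurableTypeR R * n.-tuple R] (@tuple_cons R n).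
Proof. exact: measurable_tuple_cons. Qed.

Lemma integrable_tuple_cons (f : n.+1.-tuple R -> R) : measurable_fun [set: n.+1.-tuple R] f ->
  (leb \x mu n)%E.-integrable setT (EFin \o (fun z => f (tuple_cons z))) ->
  (mu n.+1).-integrable setT (EFin \o f).
Proof.
move=> mf intf; apply/integrableP; split; first exact/measurable_EFinP.
have mEf : measurable_fun [set: n.+1.-tuple R] (EFin \o f) by exact/measurable_EFinP.
have := @integrable_pushforward _ _ _ _ R _ mcons (leb \x mu n)%E
  setT (EFin \o f) mEf intf measurableT.
by move=> /integrableP[].
Qed.

Lemma Rintegral_tuple_cons (f : n.+1.-tuple R -> R) : measurable_fun [set: n.+1.-tuple R] f ->
  (leb \x mu n)%E.-integrable setT (EFin \o (fun z => f (tuple_cons z))) ->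
  \int[mu n.+1]_x f x = \int[(leb \x mu n)%E]_z f (tuple_cons z).
Proof.
move=> mf intf; rewrite /Rintegral; congr fine.
have mEf : measurable_fun [set: n.+1.-tuple R] (EFin \o f) by exact/measurable_EFinP.
have := @integral_pushforward _ _ _ _ R _ mcons (leb \x mu n)%E
  setT (EFin \o f) mEf intf measurableT.
rewrite preimage_setT => <-.
by apply: eq_measure_integral => A mA _.
Qed.

End lebesgue_tuple_cons.

Section ptent.
Variable R : realType.
Local Notation leb := (@lebesgue_measure R).
Local Notation mu m := (lebesgue_tuple R m).

Definition ptent n d (c y : n.-tuple R) : R := \prod_(i < n) tent d (tnth c i) (tnth y i).

Definition ptent_hat n d (t : n.-tuple R) : R := \prod_(i < n) tent_hat d (tnth t i).

Lemma measurable_dotp d (T : measurableType d) n (f g : T -> n.-tuple R) :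
  measurable_fun [set: T] f -> measurable_fun [set: T] g ->
  measurable_fun [set: T] (fun z => dotp (f z) (g z)).
Proof.
move=> mf mg; apply: measurable_sum => i; apply: measurable_funM.
- exact: (measurableT_comp (measurable_tnth i)).
- exact: (measurableT_comp (measurable_tnth i)).
Qed.

Lemma measurable_cos_comp d (T : measurableType d) (f : T -> R) :
  measurable_fun [set: T] f -> measurable_fun [set: T] (fun z => cos (f z)).
Proof.
move=> mf; apply: (measurableT_comp _ mf).
exact: continuous_measurable_fun (@continuous_cos R).
Qed.

Lemma measurable_sin_comp d (T : measurableType d) (f : T -> R) :
  measurable_fun [set: T] f -> measurable_fun [set: T] (fun z => sin (f z)).
Proof.
move=> mf; apply: (measurableT_comp _ mf).
exact: continuous_measurable_fun (@continuous_sin R).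
Qed.

Lemma ptent_ge0 n d (c y : n.-tuple R) : 0 <= ptent d c y.
Proof. by apply: prodr_ge0 => i _; exact: tent_ge0. Qed.

Lemma measurable_ptent n d (c : n.-tuple R) : measurable_fun [set: n.-tuple R] (ptent d c).
Proof.
apply: measurable_prod => i _.
apply: (measurableT_comp (@measurable_tent _ d (tnth c i))).
exact: measurable_tnth.
Qed.

Lemma measurable_ptentM_cos n d (c t : n.-tuple R) a :
  measurable_fun [set: n.-tuple R] (fun y => ptent d c y * cos (a + dotp t y)).
Proof.
apply: measurable_funM; first exact: measurable_ptent.
by apply/measurable_cos_comp/measurable_funD => //; exact: measurable_dotp.
Qed.

Lemma ptent_cons n d (c : n.+1.-tuple R) z :
  ptent d c (tuple_cons z) = tent d (thead c) z.1 * ptent d [tuple of behead c] z.2.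
Proof.
rewrite /ptent big_ord_recl; congr (_ * _).
by apply: eq_bigr => i _; rewrite {1}(tuple_eta c) !tnthS.
Qed.

Lemma ptent_hat_cons n d (t : n.+1.-tuple R) :
  ptent_hat d t = tent_hat d (thead t) * ptent_hat d [tuple of behead t].
Proof.
rewrite /ptent_hat big_ord_recl; congr (_ * _).
by apply: eq_bigr => i _; rewrite {1}(tuple_eta t) !tnthS.
Qed.

Lemma dotp_cons n (t : n.+1.-tuple R) z :
  dotp t (tuple_cons z) = thead t * z.1 + dotp [tuple of behead t] z.2.
Proof.
rewrite /dotp big_ord_recl; congr (_ + _).
by apply: eq_bigr => i _; rewrite {1}(tuple_eta t) !tnthS.
Qed.

Lemma integral_tuple0 (f : 0.-tuple R -> R) : measurable_fun [set: 0.-tuple R] f ->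
  (\int[mu 0]_x (f x)%:E = (f [tuple])%:E)%E.
Proof.
move=> mf; rewrite (eq_measure_integral \d_[tuple])//.
rewrite integral_dirac//; first by rewrite diracT mul1e.
by apply/measurable_EFinP.
Qed.

Lemma integrable_ptent n d (c : n.-tuple R) : (mu n).-integrable setT (EFin \o ptent d c).
Proof.
elim: n c => [|n IH] c.
  apply/integrableP; split; first by apply/measurable_EFinP; exact: measurable_ptent.
  under eq_integral do rewrite /= ger0_norm ?ptent_ge0//.
  by rewrite integral_tuple0 ?ltry//; exact: measurable_ptent.
apply: integrable_tuple_cons; first exact: measurable_ptent.
rewrite (_ : (fun z => _) = (fun z => tent d (thead c) z.1 * ptent d [tuple of behead c] z.2)).
  exact: integrable_prod_mul (integrable_tent _ _) (IH _).
by apply/funext => z; exact: ptent_cons.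
Qed.

(** Induction on [n], peeling off the first coordinate. The inner integral is the induction
    hypothesis with [thead t * x] added to the phase; it leaves a one-dimensional integral with a
    shifted phase. *)
Lemma Rintegral_ptent_cos n d (c : n.-tuple R) a t : 0 < d ->
  \int[mu n]_y (ptent d c y * cos (a + dotp t y)) = cos (a + dotp t c) * ptent_hat d t.
Proof.
move=> d0; elim: n c a t => [|n IH] c a t.
  rewrite /Rintegral integral_tuple0; last exact: measurable_ptentM_cos.
  by rewrite /ptent_hat /ptent /dotp !big_ord0 mul1r mulr1.
rewrite Rintegral_tuple_cons.
- under eq_Rintegral do rewrite ptent_cons dotp_cons.
  rewrite (@Rintegral_prod_kernel1 _ _ _ _ R leb (mu n) (tent d (thead c))
    (ptent d [tuple of behead c]) (integrable_tent _ _) (integrable_ptent _ _)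
    (fun z => cos (a + (thead t * z.1 + dotp [tuple of behead t] z.2))) 1)/=.
  + have inner x : \int[mu n]_y (ptent d [tuple of behead c] y *
          cos (a + (thead t * x + dotp [tuple of behead t] y))) =
        cos (a + dotp [tuple of behead t] [tuple of behead c] + thead t * x) *
          ptent_hat d [tuple of behead t].
      by under eq_Rintegral do rewrite addrA; rewrite IH addrAC.
    under eq_Rintegral do rewrite inner mulrA.
    rewrite RintegralZr//; last first.
      apply: (integrable_mul_bounded (M := 1)); first exact: integrable_tent.
        apply: measurable_cos_comp; apply: measurable_funD => //.
      by move=> y; exact: cos_max.
    rewrite Rintegral_tent_cos// ptent_hat_cons mulrA; congr (cos _ * _ * _).
    have -> : dotp t c = dotp t (tuple_cons (thead c, [tuple of behead c])).
      by congr dotp; rewrite {1}(tuple_eta c).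
    by rewrite dotp_cons /=; ring.
  + apply: measurable_cos_comp; apply: measurable_funD => //.
    apply: measurable_funD; first exact: measurable_funM.
    exact: measurable_dotp.
  + by move=> z; exact: cos_max.
- exact: measurable_ptentM_cos.
- rewrite (_ : (fun z => _) = (fun z => tent d (thead c) z.1 * ptent d [tuple of behead c] z.2 *
    cos (a + dotp t (tuple_cons z)))).
    apply: (integrable_mul_bounded (M := 1)).
    + exact: integrable_prod_mul (integrable_tent _ _) (integrable_ptent _ _).
    + apply: measurable_cos_comp; apply: measurable_funD => //.
      apply: measurable_dotp => //; exact: measurable_tuple_cons.
    + by move=> z; exact: cos_max.
  by apply/funext => z; rewrite ptent_cons.
Qed.

End ptent.

(** * Finite sums of integrals and integrals over cells *)

Section Rintegral_misc.
Context d (T : measurableType d) (R : realType).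
Variable nu : {measure set T -> \bar R}.

Lemma integrable_sumr (I : Type) (s : seq I) (P : pred I) (f : I -> T -> R) :
  (forall i, nu.-integrable [set: T] (EFin \o f i)) ->
  nu.-integrable [set: T] (EFin \o (fun x => \sum_(i <- s | P i) f i x)).
Proof.
move=> intf.
rewrite (_ : _ \o _ = (fun x => \sum_(i <- s | P i) (f i x)%:E)%E).
  by apply: integrable_sum => // i _; exact: intf.
by apply/funext => x /=; rewrite sumEFin.
Qed.

Lemma Rintegral_sum (I : Type) (s : seq I) (P : pred I) (f : I -> T -> R) :
  (forall i, nu.-integrable [set: T] (EFin \o f i)) ->
  \int[nu]_x (\sum_(i <- s | P i) f i x) = \sum_(i <- s | P i) \int[nu]_x f i x.
Proof.
move=> intf; elim: s => [|i s IH].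
  by under eq_Rintegral do rewrite big_nil; rewrite Rintegral_cst// mul0r big_nil.
under eq_Rintegral do rewrite big_cons; rewrite big_cons; case: ifPn => _ //.
by rewrite RintegralD// ?IH//; exact: integrable_sumr.
Qed.

Lemma integrable_mulr (f : T -> R) (k : R) : nu.-integrable [set: T] (EFin \o f) ->
  nu.-integrable [set: T] (EFin \o (fun x => f x * k)).
Proof. by move=> intf; exact: (integrable_mul_bounded (h := cst k) (M := `|k|) intf). Qed.

Lemma integrable_mull (f : T -> R) (k : R) : nu.-integrable [set: T] (EFin \o f) ->
  nu.-integrable [set: T] (EFin \o (fun x => k * f x)).
Proof.
rewrite [X in _ -> integrable _ _ (_ \o X)](_ : _ = (fun x => f x * k)).
  exact: integrable_mulr.
by apply/funext => x; rewrite mulrC.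
Qed.

Lemma integrable_indicM (f : T -> R) (A : set T) : measurable A ->
  nu.-integrable [set: T] (EFin \o f) ->
  nu.-integrable [set: T] (EFin \o (fun x => f x * \1_A x)).
Proof.
move=> mA intf; apply: (integrable_mul_bounded (M := 1) intf).
  exact: measurable_indic.
by move=> x; rewrite indicE; case: (_ \in _); rewrite ?normr1 ?normr0 ?ler01.
Qed.

Lemma Rintegral_indicM (f : T -> R) (A : set T) :
  \int[nu]_x (f x * \1_A x) = \int[nu]_(x in A) f x.
Proof.
rewrite [RHS]Rintegral_mkcond; apply: eq_Rintegral => x _.
by rewrite patchE indicE; case: (_ \in _); rewrite ?mulr1 ?mulr0.
Qed.

Variables (I : finType) (Q : I -> set T) (g : T -> R).
Hypothesis mQ : forall i, measurable (Q i).
Hypothesis intg : nu.-integrable [set: T] (EFin \o g).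
Hypothesis gQ : forall x, g x != 0 -> exists i, Q i x.

(** Each point where [g] is nonzero is charged to one cell containing it; the terms of the other
    cells are nonnegative. *)
Lemma Rintegral_cells (h : T -> R) (M : R) (b : I -> R) :
  measurable_fun [set: T] h -> (forall x, `|h x| <= M) ->
  (forall i x, Q i x -> `|h x| <= b i) -> (forall i, 0 <= b i) ->
  `|\int[nu]_x (g x * h x)| <= \sum_i (\int[nu]_(x in Q i) `|g x|) * b i.
Proof.
move=> mh hM hb b0.
have ing := integrable_mul_bounded intg mh hM.
have inr := integrable_norm intg.
apply: (le_trans (le_normr_Rintegral measurableT ing)).
have ini i : nu.-integrable [set: T] (EFin \o (fun x => `|g x| * \1_(Q i) x * b i)).
  apply: (integrable_mul_bounded (M := `|b i|)) => //.
  exact: integrable_indicM.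
apply: (@le_trans _ _ (\int[nu]_x \sum_i (`|g x| * \1_(Q i) x * b i))).
  apply: le_Rintegral => //; [exact: (integrable_norm ing)|exact: integrable_sumr|].
  move=> x _; have [->|gx] := eqVneq (g x) 0.
    by rewrite mul0r normr0 sumr_ge0// => i _; rewrite mul0r mul0r.
  have [i Qx] := gQ gx; rewrite (bigD1 i)//= indicE mem_set// mulr1.
  rewrite normrM -[leLHS]addr0 lerD// ?ler_wpM2l// ?hb//.
  by apply: sumr_ge0 => j _; rewrite !mulr_ge0// indicE.
rewrite Rintegral_sum// ler_sum// => i _.
rewrite RintegralZr//; last exact: integrable_indicM.
by rewrite Rintegral_indicM.
Qed.

End Rintegral_misc.

(** * The tent-weighted energy of the transform as a double integral *)

Section energy.
Variables (R : realType) (n : nat).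
Local Notation nu := (lebesgue_tuple R n).
Local Notation T := (n.-tuple R).
Variables (d : R) (c : T) (g : T -> R).
Hypothesis d0 : 0 < d.
Hypothesis intg : nu.-integrable setT (EFin \o g).

(** For real [g] the Fourier transform is [cos_transform g - i sin_transform g]. *)
Definition cos_transform (y : T) : R := \int[nu]_x (g x * cos (2 * pi * dotp x y)).
Definition sin_transform (y : T) : R := \int[nu]_x (g x * sin (2 * pi * dotp x y)).

Let int_cos y : nu.-integrable setT (EFin \o (fun x => g x * cos (2 * pi * dotp x y))).
Proof.
apply: (integrable_mul_bounded (M := 1) intg) => [|x]; last exact: cos_max.
by apply/measurable_cos_comp/measurable_funM => //; exact: measurable_dotp.
Qed.

Let int_sin y : nu.-integrable setT (EFin \o (fun x => g x * sin (2 * pi * dotp x y))).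
Proof.
apply: (integrable_mul_bounded (M := 1) intg) => [|x]; last exact: sin_max.
by apply/measurable_sin_comp/measurable_funM => //; exact: measurable_dotp.
Qed.

Lemma cos_transform_le y : `|cos_transform y| <= \int[nu]_x `|g x|.
Proof.
apply: (le_trans (le_normr_Rintegral measurableT (int_cos y))).
apply: le_Rintegral => //; [exact: (integrable_norm (int_cos y))|exact: (integrable_norm intg)|].
by move=> x _; rewrite normrM ler_piMr// cos_max.
Qed.

Lemma sin_transform_le y : `|sin_transform y| <= \int[nu]_x `|g x|.
Proof.
apply: (le_trans (le_normr_Rintegral measurableT (int_sin y))).
apply: le_Rintegral => //; [exact: (integrable_norm (int_sin y))|exact: (integrable_norm intg)|].
by move=> x _; rewrite normrM ler_piMr// sin_max.
Qed.

Let mg : measurable_fun setT g.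
Proof. by apply/measurable_EFinP; case/integrableP : intg. Qed.

Lemma measurable_cos_transform : measurable_fun setT cos_transform.
Proof.
apply: (@measurable_integral_kernel _ _ _ _ _ nu (fun z => g z.2 * cos (2 * pi * dotp z.2 z.1))).
apply: measurable_funM; first exact: measurableT_comp.
by apply/measurable_cos_comp/measurable_funM => //; exact: measurable_dotp.
Qed.

Lemma measurable_sin_transform : measurable_fun setT sin_transform.
Proof.
apply: (@measurable_integral_kernel _ _ _ _ _ nu (fun z => g z.2 * sin (2 * pi * dotp z.2 z.1))).
apply: measurable_funM; first exact: measurableT_comp.
by apply/measurable_sin_comp/measurable_funM => //; exact: measurable_dotp.
Qed.

(** The frequency at which the transform of the tent is evaluated once the squared modulus of a
    transform is expanded into a double integral over [x] and [x']. *)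
Definition phase (x x' : T) : T := [tuple 2 * pi * (tnth x i - tnth x' i) | i < n].

Lemma dotp_phase x x' y : dotp (phase x x') y = 2 * pi * dotp x y - 2 * pi * dotp x' y.
Proof.
rewrite /dotp !mulr_sumr -sumrB; apply: eq_bigr => i _.
by rewrite tnth_mktuple; ring.
Qed.

Lemma measurable_phase d' (S : measurableType d') (f h : S -> T) :
  measurable_fun [set: S] f -> measurable_fun [set: S] h ->
  measurable_fun [set: S] (fun z => phase (f z) (h z)).
Proof.
move=> mf mh; apply/measurable_fun_tnthP => i.
rewrite (_ : _ \o _ = (fun z => 2 * pi * (tnth (f z) i - tnth (h z) i))); last first.
  by apply/funext => z /=; rewrite tnth_mktuple.
apply: measurable_funM => //; apply: measurable_funB.
- exact: (measurableT_comp (measurable_tnth i)).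
- exact: (measurableT_comp (measurable_tnth i)).
Qed.

Let kern (y x : T) : R := \int[nu]_x' (g x' * cos (dotp (phase x x') y)).

Let int_kern y x : nu.-integrable setT (EFin \o (fun x' => g x' * cos (dotp (phase x x') y))).
Proof.
apply: (integrable_mul_bounded (M := 1) intg) => [|x']; last exact: cos_max.
by apply/measurable_cos_comp/measurable_dotp => //; exact: measurable_phase.
Qed.

(** The addition formula for [cos (A - B)], integrated against [g(x) g(x')]. *)
Lemma sqr_transform y : cos_transform y ^+ 2 + sin_transform y ^+ 2 = \int[nu]_x (g x * kern y x).
Proof.
have kE x : kern y x = cos (2 * pi * dotp x y) * cos_transform y +
    sin (2 * pi * dotp x y) * sin_transform y.
  rewrite -!RintegralZl// -RintegralD//.
  - by apply: eq_Rintegral => x' _; rewrite dotp_phase cosB; ring.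
  - exact: integrable_mull.
  - exact: integrable_mull.
under eq_Rintegral do rewrite kE mulrDr !mulrA.
rewrite RintegralD//; [|exact: integrable_mulr|exact: integrable_mulr].
by rewrite !RintegralZr// !expr2.
Qed.

Lemma kern_le y x : `|kern y x| <= \int[nu]_x `|g x|.
Proof.
apply: (le_trans (le_normr_Rintegral measurableT (int_kern y x))).
apply: le_Rintegral => //; [exact: (integrable_norm (int_kern y x))|exact: (integrable_norm intg)|].
by move=> x' _; rewrite normrM ler_piMr// cos_max.
Qed.

Lemma measurable_kern : measurable_fun setT (fun z : T * T => kern z.1 z.2).
Proof.
apply: (@measurable_integral_kernel _ _ _ _ _ nu
  (fun z : (T * T) * T => g z.2 * cos (dotp (phase z.1.2 z.2) z.1.1))).
apply: measurable_funM; first exact: measurableT_comp.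
apply/measurable_cos_comp/measurable_dotp; last exact: measurableT_comp.
by apply: measurable_phase => //; exact: measurableT_comp.
Qed.

(** Two applications of Fubini, against [x] and then against [x'], bring the [y]-integral to the
    inside, where it is the transform of the tent. *)
Lemma energyE : \int[nu]_y (ptent d c y * (cos_transform y ^+ 2 + sin_transform y ^+ 2)) =
  \int[nu]_x (g x * \int[nu]_x' (g x' *
     (cos (dotp (phase x x') c) * ptent_hat d (phase x x')))).
Proof.
under eq_Rintegral do rewrite sqr_transform.
rewrite (Rfubini (integrable_ptent d c) intg (k := fun z => kern z.1 z.2) measurable_kern
  (fun z => kern_le z.1 z.2)).
apply: eq_Rintegral => x _; congr (_ * _).
rewrite (Rfubini (integrable_ptent d c) intg (k := fun z => cos (dotp (phase x z.2) z.1)) (M := 1)).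
- apply: eq_Rintegral => x' _; congr (_ * _).
  have := Rintegral_ptent_cos c 0 (phase x x') d0; rewrite add0r => <-.
  by apply: eq_Rintegral => y _; rewrite add0r.
- by apply/measurable_cos_comp/measurable_dotp => //; exact: measurable_phase.
- by move=> z; exact: cos_max.
Qed.

End energy.

Section energy_cells.
Variables (R : realType) (n : nat).
Local Notation nu := (lebesgue_tuple R n).
Local Notation T := (n.-tuple R).
Variables (d : R) (c : T) (g : T -> R).
Hypothesis d0 : 0 < d.
Hypothesis intg : nu.-integrable setT (EFin \o g).
Variables (I : finType) (Q : I -> set T) (K : I -> I -> R).
Hypothesis mQ : forall i, measurable (Q i).
Hypothesis gQ : forall x, g x != 0 -> exists i, Q i x.
Hypothesis K_ge0 : forall i j, 0 <= K i j.
Hypothesis KQ : forall i j x x', Q i x -> Q j x' -> ptent_hat d (phase x x') <= K i j.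

Let H (x x' : T) : R := cos (dotp (phase x x') c) * ptent_hat d (phase x x').

(** As an integral in [y], [H] is jointly measurable and bounded by [M]; the closed form hides this
    behind the case distinction at frequency 0. *)
Let HE x x' : H x x' = \int[nu]_y (ptent d c y * cos (dotp (phase x x') y)).
Proof.
have := Rintegral_ptent_cos c 0 (phase x x') d0; rewrite add0r -/(H x x') => <-.
by apply: eq_Rintegral => y _; rewrite add0r.
Qed.

Let mH : measurable_fun setT (fun z : T * T => H z.1 z.2).
Proof.
under eq_fun do rewrite HE.
apply: (@measurable_integral_kernel _ _ _ _ _ nu
  (fun z : (T * T) * T => ptent d c z.2 * cos (dotp (phase z.1.1 z.1.2) z.2))).
apply: measurable_funM; first exact: (measurableT_comp (measurable_ptent d c)).
apply/measurable_cos_comp/measurable_dotp; last by [].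
by apply: measurable_phase => //; exact: measurableT_comp.
Qed.

Let M := \int[nu]_y ptent d c y.

Let HM x x' : `|H x x'| <= M.
Proof.
rewrite HE; have ii : nu.-integrable setT (EFin \o (fun y => ptent d c y * cos (dotp (phase x x') y))).
  apply: (integrable_mul_bounded (M := 1) (integrable_ptent d c)) => [|y]; last exact: cos_max.
  exact/measurable_cos_comp/measurable_dotp.
apply: (le_trans (le_normr_Rintegral measurableT ii)).
apply: le_Rintegral => //; [exact: (integrable_norm ii)|exact: integrable_ptent|].
by move=> y _; rewrite normrM (ger0_norm (ptent_ge0 _ _ _)) ler_piMr ?ptent_ge0 ?cos_max.
Qed.

Let ptent_hat_ge0 (t : T) : 0 <= ptent_hat d t.
Proof. by apply: prodr_ge0 => i _; exact: tent_hat_ge0. Qed.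

Let a i := \int[nu]_(x in Q i) `|g x|.

Let HK i j x x' : Q i x -> Q j x' -> `|H x x'| <= K i j.
Proof.
move=> Qx Qx'; rewrite normrM (ger0_norm (ptent_hat_ge0 _)).
by apply: le_trans (KQ Qx Qx'); rewrite ler_piMl// cos_max.
Qed.

(** [Rintegral_cells] is used for the outer variable, with the inner integral as bounded factor, and
    again for the inner variable. *)
Lemma energy_le_cells :
  \int[nu]_y (ptent d c y * (cos_transform g y ^+ 2 + sin_transform g y ^+ 2)) <=
  \sum_i a i * \sum_j a j * K i j.
Proof.
rewrite energyE//; apply: (le_trans (ler_norm _)).
have mHx x : measurable_fun setT (H x) by exact: (measurableT_comp mH (pair1_measurable x)).
have a0 i : 0 <= a i by exact: Rintegral_ge0.
apply: (Rintegral_cells mQ intg gQ (M := M * \int[nu]_x `|g x|)).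
- apply: (@measurable_integral_kernel _ _ _ _ _ nu (fun z => g z.2 * H z.1 z.2)).
  apply: measurable_funM => //; apply: measurableT_comp => //.
  by apply/measurable_EFinP; case/integrableP : intg.
- move=> x; have ii := integrable_mul_bounded intg (mHx x) (HM x).
  apply: (le_trans (le_normr_Rintegral measurableT ii)).
  rewrite -RintegralZl//; last exact: (integrable_norm intg).
  apply: le_Rintegral => //; first exact: (integrable_norm ii).
    exact/integrable_mull/(integrable_norm intg).
  by move=> x' _; rewrite normrM mulrC ler_wpM2r.
- move=> i x Qx; apply: (Rintegral_cells mQ intg gQ (M := M)).
  + exact: mHx.
  + exact: HM.
  + by move=> j x' Qx'; exact: HK.
  + by move=> j; exact: K_ge0.
- by move=> i; apply: sumr_ge0 => j _; rewrite mulr_ge0.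
Qed.

End energy_cells.

(* Schur's test *)
Lemma sum_kernel_le (R : realType) (I : finType) (a : I -> R) (K : I -> I -> R) (S : R) :
  (forall i j, 0 <= K i j) -> (forall i j, K i j = K j i) ->
  (forall i, \sum_j K i j <= S) -> (forall i, 0 <= a i) ->
  \sum_i a i * \sum_j a j * K i j <= S * \sum_i a i ^+ 2.
Proof.
move=> K0 KC KS a0.
have s1 : \sum_i \sum_j a i ^+ 2 * K i j <= S * \sum_i a i ^+ 2.
  rewrite mulr_sumr ler_sum// => i _; rewrite -mulr_sumr mulrC ler_wpM2r ?sqr_ge0//.
have s2 : \sum_i \sum_j a j ^+ 2 * K i j <= S * \sum_i a i ^+ 2.
  rewrite exchange_big/=; under eq_bigr do under eq_bigr do rewrite KC.
  exact: s1.
have : \sum_i a i * \sum_j a j * K i j <=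
    \sum_i \sum_j a i ^+ 2 * K i j / 2 + \sum_i \sum_j a j ^+ 2 * K i j / 2.
  rewrite -big_split/= ler_sum// => i _; rewrite -big_split/= mulr_sumr ler_sum// => j _.
  rewrite -mulrDl -mulrDl mulrA [leRHS]mulrAC ler_wpM2r//.
  by have := sqr_ge0 (a i - a j); rewrite sqrrB; lra.
under [X in _ <= X + _ -> _]eq_bigr do rewrite -mulr_suml.
under [X in _ <= _ + X -> _]eq_bigr do rewrite -mulr_suml.
rewrite -!mulr_suml; lra.
Qed.

(** * Dyadic cubes and the summable lattice kernel *)

Section lattice_kernel.
Variable R : realType.

Let F (x : R) : R := x / (1 + `|x|).

Let F_le1 x : `|F x| <= 1.
Proof.
rewrite /F normrM normfV [X in _ / X]ger0_norm; last by rewrite addr_ge0.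
by rewrite ler_pdivrMr ?mul1r ?lerDr// ltr_pwDl.
Qed.

(** [F] increases from -1 to 1 with derivative [(1 + |x|)^-2], which is comparable with
    [(1 + x^2)^-1]. *)
Let F_step (k : int) :
  (1 + (k%:~R : R) ^+ 2)^-1 <= 4 * (F ((k + 1)%:~R) - F (k%:~R)).
Proof.
have p1 : 0 < 1 + (k%:~R : R) ^+ 2 by rewrite ltr_pwDl// sqr_ge0.
rewrite /F rmorphD/=; set x : R := k%:~R in p1 *.
have [k0|k0] := leP 0 k.
  have x0 : 0 <= x by rewrite ler0z.
  rewrite !ger0_norm ?addr_ge0//.
  have -> : 4 * ((x + 1) / (1 + (x + 1)) - x / (1 + x)) = 4 / ((2 + x) * (1 + x)).
    by field; apply/andP; split; lra.
  rewrite ler_pdivlMr ?ler_pdivrMl//; [nra|].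
  by rewrite mulr_gt0//; lra.
(* A negative integer is at most -1, so [k] and [k + 1] are both nonpositive and the kink of [F] at
   0 is never inside the interval. *)
have x1 : x <= -1.
  have : k <= -1 by rewrite -ltzD1 addNr.
  by rewrite -(ler_int R) mulrN1z.
rewrite !ler0_norm; [|lra|lra].
have -> : 4 * ((x + 1) / (1 - (x + 1)) - x / (1 - x)) = 4 / (- x * (1 - x)).
  by field; apply/andP; split; lra.
rewrite ler_pdivlMr ?ler_pdivrMl//; [nra|].
by rewrite mulr_gt0//; lra.
Qed.

(* Telescoping along [F x = x / (1 + |x|)]. *)
Lemma sum_inv_sqr_le (M : nat) (z : int) :
  \sum_(j < M) (1 + ((z - j%:Z)%:~R : R) ^+ 2)^-1 <= 8.
Proof.
have h N : \sum_(j < N) (1 + ((j%:Z - z)%:~R : R) ^+ 2)^-1 <=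
    4 * (F (N%:Z - z)%:~R - F (- z)%:~R).
  elim: N => [|N IH]; first by rewrite big_ord0 sub0r subrr mulr0.
  rewrite big_ord_recr/=; apply: le_trans (lerD IH (F_step _)) _.
  have -> : (N%:Z - z + 1) = (N.+1%:Z - z) by rewrite -addn1 PoszD addrAC.
  lra.
under eq_bigr do rewrite -[_ ^+ 2]sqrrN -rmorphN opprB.
apply: (le_trans (h M)).
have := F_le1 (M%:Z - z)%:~R; have := F_le1 (- z)%:~R.
by rewrite !ler_norml => /andP[? ?] /andP[? ?]; lra.
Qed.

End lattice_kernel.

Section cubes.
Variables (R : realType) (n : nat) (m : int).
Local Notation nu := (lebesgue_tuple R n).
Local Notation T := (n.-tuple R).
Local Notation cube := (dyadic_cube R n m).

Let delta : R := 2 ^ m.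
Let delta_gt0 : 0 < delta. Proof. exact: exprz_gt0. Qed.

Lemma measurable_dyadic_cube k : measurable (cube k).
Proof.
rewrite (_ : cube k = \bigcap_(i in [set: 'I_n]) [set x : T |
    `[0, delta[%classic (tnth x i - delta * (tnth k i)%:~R)]).
  apply: fin_bigcap_measurable => [|i _]; first exact: finite_finset.
  rewrite -[X in measurable X]setTI.
  apply: (_ : measurable_fun setT (fun x : T => tnth x i - delta * (tnth k i)%:~R)) => //.
  by apply: measurable_funB => //; exact: measurable_tnth.
apply/seteqP; split => x /= H i; first by move=> _ /=; rewrite in_itv/=; exact: H.
by have := H i I; rewrite /= in_itv.
Qed.

Lemma dyadic_cube_inj k k' x : cube k x -> cube k' x -> k = k'.
Proof.
move=> kx k'x; apply: eq_from_tnth => i.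
have /andP[a1 a2] := kx i; have /andP[b1 b2] := k'x i.
have h (u v : int) : 0 <= tnth x i - delta * u%:~R -> tnth x i - delta * v%:~R < delta -> u <= v.
  move=> h1 h2; have : delta * u%:~R < delta * (v + 1)%:~R.
    by rewrite rmorphD/= mulrDr mulr1; lra.
  by rewrite ltr_pM2l// ltr_int ltzD1.
by apply/eqP; rewrite eq_le (h _ _ a1 b2) (h _ _ b1 a2).
Qed.

(** [15 = 5 * 3]: the 5 of [tent_hat_le], and a 3 for replacing the difference of two points by the
    difference of their cube indices. *)
Definition lattice_kernel (d : R) (k k' : n.-tuple int) : R :=
  \prod_(i < n) (15 * d ^+ 2 * (1 + ((tnth k i - tnth k' i)%:~R) ^+ 2)^-1).

Lemma lattice_kernel_ge0 d k k' : 0 <= lattice_kernel d k k'.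
Proof.
apply: prodr_ge0 => i _; rewrite mulr_ge0 ?invr_ge0//; last by rewrite addr_ge0// sqr_ge0.
by rewrite mulr_ge0// sqr_ge0.
Qed.

Lemma lattice_kernelC d k k' : lattice_kernel d k k' = lattice_kernel d k' k.
Proof.
apply: eq_bigr => i _; congr (_ * (1 + _)^-1).
by rewrite -sqrrN -rmorphN opprB.
Qed.

(** For [d = 2 / delta] the product of [d] and a coordinate of the phase is [4 pi tau], with [tau]
    the coordinate difference in units of the side. The integer [D] is within distance 1 of [tau],
    so [1 + D^2] and [1 + tau^2] are comparable. *)
Lemma ptent_hat_phase_le k k' x x' : cube k x -> cube k' x' ->
  ptent_hat (2 / delta) (phase x x') <= lattice_kernel (2 / delta) k k'.
Proof.
move=> kx k'x'; apply: ler_prod => i _; rewrite tent_hat_ge0/=.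
have d0 : 0 < 2 / delta by rewrite divr_gt0.
apply: (le_trans (tent_hat_le _ d0)); rewrite tnth_mktuple.
have /andP[a1 a2] := kx i; have /andP[b1 b2] := k'x' i.
set D : R := (tnth k i - tnth k' i)%:~R.
pose tau := (tnth x i - tnth x' i) / delta.
have [t1 t2] : tau - D < 1 /\ D - tau < 1.
  have tE : tau * delta = tnth x i - tnth x' i by rewrite /tau divfK// gt_eqF.
  rewrite -/delta in a1 a2 b1 b2.
  by split; rewrite -(ltr_pM2r delta_gt0) mulrBl tE mul1r /D rmorphB/= mulrBl; lra.
have -> : 2 / delta * (2 * pi * (tnth x i - tnth x' i)) = 4 * pi * tau.
  by rewrite /tau; field; rewrite gt_eqF.
have pi1 : (1 : R) <= 4 * pi by have := pi_ge2 R; lra.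
have q1 : tau ^+ 2 <= (4 * pi * tau) ^+ 2.
  by rewrite (exprMn _ (4 * pi)) -[leLHS]mul1r ler_wpM2r ?sqr_ge0// expr_ge1//; lra.
have q3 : 0 <= tau ^+ 2 by exact: sqr_ge0.
(* This is [D^2 <= 2 tau^2 + 2 (D - tau)^2] with [(D - tau)^2 <= 1]; the product in [e1] equals
   [1 - (D - tau)^2]. *)
have q2 : 1 + D ^+ 2 <= 3 * (1 + tau ^+ 2).
  have e1 : 0 <= (1 - (tau - D)) * (1 - (D - tau)) by rewrite mulr_ge0// subr_ge0 ltW.
  by have := sqr_ge0 (2 * tau - D); lra.
have q4 : 0 <= D ^+ 2 by exact: sqr_ge0.
rewrite ler_pdivrMr; last lra.
rewrite mulrAC ler_pdivlMr; last lra.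
have s0 : 0 <= (2 / delta) ^+ 2 by exact: sqr_ge0.
set s := (2 / delta) ^+ 2 in s0 *; set P := (4 * pi * tau) ^+ 2 in q1 *.
have := ler_wpM2l s0 q2; have := ler_wpM2l s0 q1; lra.
Qed.

Section box.
Variable L : nat.

(** Indexing the [(2L)^n] cubes around the origin by functions on the coordinates gives a finite
    type over which sums of products factor. *)
Definition corner (f : {ffun 'I_n -> 'I_(L + L)}) : n.-tuple int :=
  [tuple (f i)%:Z - L%:Z | i < n].

Lemma corner_inj : injective corner.
Proof.
move=> f g /(congr1 (fun t => tnth t)) fg; apply/ffunP => i; apply: val_inj => /=.
have := congr1 (fun h => h i) fg; rewrite !tnth_mktuple => /addIr.
by case.
Qed.

(** Summing a product over all functions gives the product of the one-dimensional sums, each at most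
    8, and [120 = 15 * 8]. The bound does not see the size [L] of the box. *)
Lemma sum_lattice_kernel_le d f :
  \sum_g lattice_kernel d (corner f) (corner g) <= (120 * d ^+ 2) ^+ n.
Proof.
rewrite /lattice_kernel.
under eq_bigr do under eq_bigr do rewrite !tnth_mktuple.
rewrite -(bigA_distr_bigA (fun (i : 'I_n) (j : 'I_(L + L)) => 15 * d ^+ 2 *
  (1 + ((f i)%:Z - L%:Z - (j%:Z - L%:Z))%:~R ^+ 2)^-1))/=.
rewrite -[X in _ <= _ ^+ X]card_ord -prodr_const; apply: ler_prod => i _.
rewrite -mulr_sumr; apply/andP; split.
  apply: mulr_ge0; [by rewrite mulr_ge0 ?sqr_ge0|apply: sumr_ge0 => j _].
  by rewrite invr_ge0 addr_ge0// sqr_ge0.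
rewrite (_ : 120 * d ^+ 2 = 15 * d ^+ 2 * 8); last by ring.
apply: ler_wpM2l; first by rewrite mulr_ge0// sqr_ge0.
under eq_bigr do rewrite opprB addrA subrK.
exact: sum_inv_sqr_le.
Qed.

Definition cubes_of (A : {set {ffun 'I_n -> 'I_(L + L)}}) : set T :=
  [set x | exists2 f, f \in A & cube (corner f) x].

Lemma measurable_cubes_of A : measurable (cubes_of A).
Proof.
rewrite (_ : cubes_of A = \bigcup_(f in [set f | f \in A]) cube (corner f)).
  apply: fin_bigcup_measurable => [|f _]; first exact: finite_finset.
  exact: measurable_dyadic_cube.
by apply/seteqP; split => x /= [f fA fx]; exists f.
Qed.

End box.

Lemma cubes_ofT_exhaust x : \forall L \near \oo, cubes_of [set: {ffun 'I_n -> 'I_(L + L)}] x.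
Proof.
pose k i := Num.floor (tnth x i / delta).
pose L0 := (\max_(i < n) `|k i|%N).+1.
exists L0 => // L /= L0L.
have kL i : (`|k i| < L)%N.
  by apply: leq_trans L0L; rewrite ltnS (leq_bigmax i).
have k2 i : (absz (k i + L%:Z)%R < L + L)%N by have := kL i; lia.
exists [ffun i => Ordinal (k2 i)]; first by rewrite inE.
move=> i; rewrite tnth_mktuple ffunE/=.
have -> : Posz (absz (k i + L%:Z)) - L%:Z = k i by have := kL i; lia.
have /andP[f1 f2] := floor_itv (tnth x i / delta).
rewrite -/(k i) in f1 f2.
rewrite -/delta; move: f1 f2; rewrite ler_pdivlMr// ltr_pdivrMr// rmorphD/= => f1 f2.
by apply/andP; split; lra.
Qed.

End cubes.

(** * Complex modulus and elementary bounds for the Fourier transform *)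

Section cmod.
Variable R : realType.
Implicit Types z : R[i].

Lemma cmod_ge0 z : 0 <= cmod z. Proof. exact: sqrtr_ge0. Qed.

Lemma sqr_cmod z : cmod z ^+ 2 = complex.Re z ^+ 2 + complex.Im z ^+ 2.
Proof. by rewrite sqr_sqrtr// addr_ge0 ?sqr_ge0. Qed.

Lemma cmod_leD z : cmod z <= `|complex.Re z| + `|complex.Im z|.
Proof.
rewrite -(@ler_pXn2r _ 2)// ?nnegrE ?cmod_ge0 ?addr_ge0//.
rewrite sqr_cmod -(real_normK (num_real (complex.Re z))) -(real_normK (num_real (complex.Im z))).
have := normr_ge0 (complex.Re z); have := normr_ge0 (complex.Im z).
set a := `|_|; set b := `|_| => a0 b0; have := mulr_ge0 a0 b0.
by rewrite sqrrD; lra.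
Qed.

Lemma Re_le_cmod z : `|complex.Re z| <= cmod z.
Proof.
by rewrite -(@ler_pXn2r _ 2)// ?nnegrE ?cmod_ge0// sqr_cmod real_normK ?num_real// lerDl sqr_ge0.
Qed.

Lemma Im_le_cmod z : `|complex.Im z| <= cmod z.
Proof.
by rewrite -(@ler_pXn2r _ 2)// ?nnegrE ?cmod_ge0// sqr_cmod real_normK ?num_real// lerDr sqr_ge0.
Qed.

Lemma cmod0 : cmod (0 : R[i]) = 0.
Proof. by rewrite /cmod /= expr0n addr0 sqrtr0. Qed.

Lemma cmodD z z' : cmod (z + z') <= cmod z + cmod z'.
Proof.
have cE w : cmod w = complex.ComplexField.Normc.normc w by case: w.
by rewrite !cE; exact: complex.le_normcD.
Qed.

Lemma cmod_sum (I : Type) (s : seq I) (F : I -> R[i]) :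
  cmod (\sum_(i <- s) F i) <= \sum_(i <- s) cmod (F i).
Proof.
elim: s => [|i s IH]; first by rewrite !big_nil cmod0.
by rewrite !big_cons (le_trans (cmodD _ _))// lerD2l.
Qed.

Lemma Re_sum (I : Type) (s : seq I) (F : I -> R[i]) :
  complex.Re (\sum_(i <- s) F i) = \sum_(i <- s) complex.Re (F i).
Proof. by elim: s => [|i s IH]; rewrite ?big_nil ?big_cons//= -IH; case: (F i) (\sum_(j <- s) F j) => [? ?] [? ?]. Qed.

Lemma Im_sum (I : Type) (s : seq I) (F : I -> R[i]) :
  complex.Im (\sum_(i <- s) F i) = \sum_(i <- s) complex.Im (F i).
Proof. by elim: s => [|i s IH]; rewrite ?big_nil ?big_cons//= -IH; case: (F i) (\sum_(j <- s) F j) => [? ?] [? ?]. Qed.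

Lemma measurable_cmod d (T : measurableType d) (f : T -> R[i]) :
  cmeasurable f -> measurable_fun [set: T] (fun x => cmod (f x)).
Proof.
move=> [mr mi]; apply: (@measurableT_comp _ _ _ _ _ _ (@Num.sqrt R)).
  exact: continuous_measurable_fun (@sqrt_continuous R).
by apply: measurable_funD; exact: measurable_funX.
Qed.

Section integrable.
Context d (T : measurableType d) (nu : {measure set T -> \bar R}).
Variable f : T -> R[i].
Hypothesis intf : cintegrable nu f.

Lemma cintegrable_cmeasurable : cmeasurable f.
Proof.
by case: intf => /integrableP[/measurable_EFinP ? _] /integrableP[/measurable_EFinP ? _].
Qed.

Lemma integrable_cmod : nu.-integrable setT (EFin \o (fun x => cmod (f x))).
Proof.
have [ir ii] := intf.
apply: (@le_integrable _ _ _ _ _ measurableT _ (EFin \o (fun x => `|complex.Re (f x)| + `|complex.Im (f x)|))).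
- by apply/measurable_EFinP; exact/measurable_cmod/cintegrable_cmeasurable.
- move=> x _ /=; rewrite lee_fin ger0_norm ?cmod_ge0// (le_trans (cmod_leD _))//.
  by rewrite ler_norm.
- have := integrableD measurableT (integrable_norm ir) (integrable_norm ii).
  by congr (_.-integrable _ _); apply/funext => x /=; rewrite EFinD.
Qed.

End integrable.

End cmod.

Section fourier.
Variables (R : realType) (n : nat).
Local Notation nu := (lebesgue_tuple R n).
Local Notation T := (n.-tuple R).

Definition crestr (f : T -> R[i]) (X : set T) (x : T) : R[i] :=
  Complex (complex.Re (f x) * \1_X x) (complex.Im (f x) * \1_X x).

Lemma cintegrable_crestr f X : measurable X -> cintegrable nu f -> cintegrable nu (crestr f X).
Proof. by move=> mX [ir ii]; split; exact: integrable_indicM. Qed.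

Lemma crestr_cmod f X x : cmod (crestr f X x) = cmod (f x) * \1_X x.
Proof.
by rewrite /cmod /= !exprMn -mulrDl sqrtrM ?addr_ge0 ?sqr_ge0// sqrtr_sqr ger0_norm.
Qed.

Let it (g : T -> R) y : nu.-integrable setT (EFin \o g) ->
  nu.-integrable setT (EFin \o (fun x => g x * cos (2 * pi * dotp x y))) /\
  nu.-integrable setT (EFin \o (fun x => g x * sin (2 * pi * dotp x y))).
Proof.
move=> ig; split.
  apply: (integrable_mul_bounded (M := 1) ig) => [|x]; last exact: cos_max.
  by apply/measurable_cos_comp/measurable_funM => //; exact: measurable_dotp.
apply: (integrable_mul_bounded (M := 1) ig) => [|x]; last exact: sin_max.
by apply/measurable_sin_comp/measurable_funM => //; exact: measurable_dotp.
Qed.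

Lemma fourierE (f : T -> R[i]) y : cintegrable nu f -> fourier f y =
  Complex (cos_transform (fun x => complex.Re (f x)) y + sin_transform (fun x => complex.Im (f x)) y)
    (cos_transform (fun x => complex.Im (f x)) y - sin_transform (fun x => complex.Re (f x)) y).
Proof.
move=> intf; have [ir ii] := intf; have [rc rs] := it y ir; have [ic js] := it y ii.
rewrite /fourier /cintegral; congr Complex.
  rewrite -RintegralD//; apply: eq_Rintegral => x _.
  by case: (f x) => a b /=; rewrite cosN sinN mulrN opprK.
rewrite -RintegralB//; apply: eq_Rintegral => x _.
by case: (f x) => a b /=; rewrite cosN sinN mulrN addrC.
Qed.

Variable f : T -> R[i].
Hypothesis intf : cintegrable nu f.
Local Notation fr := (fun x => complex.Re (f x)).
Local Notation fi := (fun x => complex.Im (f x)).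

Lemma cmeasurable_fourier : cmeasurable (fourier f).
Proof.
have [ir ii] := intf; split; under eq_fun do rewrite fourierE//=.
- by apply: measurable_funD; [exact: measurable_cos_transform|exact: measurable_sin_transform].
- by apply: measurable_funB; [exact: measurable_cos_transform|exact: measurable_sin_transform].
Qed.

(** The 4 counts the real integrals in [fourierE], each at most the integral of the modulus. *)
Lemma cmod_fourier_le y : cmod (fourier f y) <= 4 * \int[nu]_x cmod (f x).
Proof.
have [ir ii] := intf; have [rc rs] := it y ir; have [ic js] := it y ii.
have le (g k : T -> R) : nu.-integrable setT (EFin \o (fun x => g x * k x)) ->
    (forall x, `|g x| <= cmod (f x)) -> (forall x, `|k x| <= 1) ->
    `|\int[nu]_x (g x * k x)| <= \int[nu]_x cmod (f x).
  move=> igk gf k1; apply: (le_trans (le_normr_Rintegral measurableT igk)).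
  apply: le_Rintegral => //; [exact: (integrable_norm igk)|exact: integrable_cmod|].
  by move=> x _; rewrite normrM -[leRHS]mulr1 ler_pM.
have l1 := le _ _ rc (fun x => Re_le_cmod (f x)) (fun x => cos_max _).
have l2 := le _ _ rs (fun x => Re_le_cmod (f x)) (fun x => sin_max _).
have l3 := le _ _ ic (fun x => Im_le_cmod (f x)) (fun x => cos_max _).
have l4 := le _ _ js (fun x => Im_le_cmod (f x)) (fun x => sin_max _).
apply: (le_trans (cmod_leD _)); rewrite fourierE//=.
apply: (le_trans (lerD (ler_normD _ _) (ler_normB _ _))).
rewrite (_ : 4 = 2 + 2); last by ring.
by rewrite mulrDl !mulr_natl !mulr2n !lerD.
Qed.

(** Decouples the real and imaginary parts of [f], so that the energy identity for real functions
    applies to each. *)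
Lemma sqr_cmod_fourier_le y : cmod (fourier f y) ^+ 2 <=
  2 * (cos_transform fr y ^+ 2 + sin_transform fr y ^+ 2) +
  2 * (cos_transform fi y ^+ 2 + sin_transform fi y ^+ 2).
Proof.
rewrite sqr_cmod fourierE//=; set a := cos_transform _ _; set b := sin_transform _ _.
set c := cos_transform _ _; set d := sin_transform _ _.
by have := sqr_ge0 (a - b); have := sqr_ge0 (c + d); move: a b c d => a b c d; lra.
Qed.

Lemma cmod_fourier_split (I : finType) (X : I -> set T) y :
  (forall i, measurable (X i)) -> (forall x, \sum_i \1_(X i) x = 1 :> R) ->
  cmod (fourier f y) <= \sum_i cmod (fourier (crestr f (X i)) y).
Proof.
move=> mX X1; suff -> : fourier f y = \sum_i fourier (crestr f (X i)) y by exact: cmod_sum.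
have [ir ii] := intf.
have h (g k : T -> R) : nu.-integrable setT (EFin \o (fun x => g x * k x)) ->
    \int[nu]_x (g x * k x) = \sum_i \int[nu]_x (g x * \1_(X i) x * k x).
  move=> igk; rewrite -Rintegral_sum.
    apply: eq_Rintegral => x _; rewrite -mulr_suml -mulr_sumr X1.
    by rewrite mulr1.
  move=> i; have := integrable_indicM (mX i) igk.
  by congr (_.-integrable _ (EFin \o _)); apply/funext => x; rewrite mulrAC.
have [rc rs] := it y ir; have [ic js] := it y ii.
have rE : complex.Re (fourier f y) = \sum_i complex.Re (fourier (crestr f (X i)) y).
  rewrite [in LHS]fourierE// [LHS]/= /cos_transform /sin_transform (h _ _ rc) (h _ _ js) -big_split.
  by apply: eq_bigr => i _; rewrite fourierE; last exact: cintegrable_crestr.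
have iE : complex.Im (fourier f y) = \sum_i complex.Im (fourier (crestr f (X i)) y).
  rewrite [in LHS]fourierE// [LHS]/= /cos_transform /sin_transform (h _ _ rs) (h _ _ ic) -sumrB.
  by apply: eq_bigr => i _; rewrite fourierE; last exact: cintegrable_crestr.
by apply/eqP; rewrite eq_complex Re_sum Im_sum rE iE !eqxx.
Qed.

End fourier.

(** * Majorising the indicator of a ball by a product tent *)

Section ball.
Variables (R : realType) (n : nat).
Local Notation nu := (lebesgue_tuple R n).
Local Notation T := (n.-tuple R).

Lemma measurable_eball (c : T) (r : R) : measurable (eball c r).
Proof.
have -> : eball c r = (fun y => Num.sqrt (\sum_(i < n) (tnth y i - tnth c i) ^+ 2)) @^-1` `]-oo, r[%classic.
  by apply/seteqP; split => y /=; rewrite /eball/= in_itv.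
rewrite -[X in measurable X]setTI.
apply: (_ : measurable_fun setT (fun y : T => Num.sqrt (\sum_(i < n) (tnth y i - tnth c i) ^+ 2))) => //.
apply: (@measurableT_comp _ _ _ _ _ _ (@Num.sqrt R)).
  exact: continuous_measurable_fun (@sqrt_continuous R).
apply: measurable_sum => i; apply: measurable_funX.
by apply: measurable_funB => //; exact: measurable_tnth.
Qed.

Lemma eball_tnth (c y : T) (r : R) i : eball c r y -> `|tnth y i - tnth c i| < r.
Proof.
rewrite /eball/=; apply: le_lt_trans; rewrite -sqrtr_sqr ler_wsqrtr//.
by rewrite (bigD1 i)//= lerDl sumr_ge0// => j _; exact: sqr_ge0.
Qed.

Variables (d r : R) (c : T).
Hypotheses (d0 : 0 < d) (rd : r <= d / 2).

Lemma ptent_ball y : eball c r y -> (d / 2) ^+ n <= ptent d c y.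
Proof.
move=> yB; rewrite /ptent -[X in _ ^+ X]card_ord -prodr_const; apply: ler_prod => i _.
rewrite divr_ge0 ?(ltW d0)//= /tent le_max; apply/orP; right.
rewrite lerBrDr -lerBrDl (le_trans (ltW (eball_tnth i yB)))// (le_trans rd)//.
by rewrite {2}(splitr d) addrK.
Qed.

(** By [ptent_ball], [(2 / d)^n ptent] is at least 1 on the ball, and it is nonnegative
    elsewhere. *)
Lemma integral_ball_le (k : T -> R) (M : R) : measurable_fun setT k ->
  (forall y, 0 <= k y <= M) ->
  (\int[nu]_(y in eball c r) (k y)%:E <= ((2 / d) ^+ n * \int[nu]_y (ptent d c y * k y))%:E)%E.
Proof.
move=> mk kM.
have ipk : nu.-integrable setT (EFin \o (fun y => ptent d c y * k y)).
  apply: (integrable_mul_bounded (M := M) (integrable_ptent d c)) => // y.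
  by have /andP[k0 ?] := kM y; rewrite ger0_norm.
rewrite -RintegralZl// /Rintegral fineK; last first.
  by apply: integrable_fin_num => //; exact: integrable_mull.
rewrite [leLHS]integral_mkcond; apply: ge0_le_integral => //.
- by move=> y _; rewrite patchE; case: ifPn => // _; rewrite lee_fin; have /andP[] := kM y.
- apply/(measurable_restrictT _ _).1; first exact: measurable_eball.
  by apply/measurable_EFinP/measurable_funTS.
- apply/measurable_EFinP/measurable_funM => //; apply: measurable_funM => //.
  exact: measurable_ptent.
- move=> y _; rewrite patchE; have /andP[k0 _] := kM y; case: ifPn => [|_].
    rewrite inE => yB; rewrite lee_fin mulrA ler_peMl//.
    have e1 : (2 / d) ^+ n * (d / 2) ^+ n = 1.
      by rewrite -exprMn (_ : 2 / d * (d / 2) = 1) ?expr1n//; field; rewrite gt_eqF.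
    by rewrite -[leLHS]e1 ler_wpM2l ?ptent_ball// exprn_ge0// divr_ge0// ltW.
  by rewrite lee_fin mulr_ge0 ?mulr_ge0 ?ptent_ge0 ?exprn_ge0// divr_ge0// ltW.
Qed.

Lemma Rintegral_ptent : \int[nu]_y ptent d c y = (d ^+ 2) ^+ n.
Proof.
have := Rintegral_ptent_cos c 0 [tuple 0 | i < n] d0.
have z y : dotp [tuple 0 | i < n] y = 0.
  by rewrite /dotp big1// => i _; rewrite tnth_mktuple mul0r.
under eq_Rintegral do rewrite z addr0 cos0 mulr1.
rewrite z addr0 cos0 mul1r => ->; rewrite /ptent_hat.
under eq_bigr do rewrite tnth_mktuple /tent_hat eqxx.
by rewrite prodr_const card_ord.
Qed.

(** The same majorant with [k = 1]: [(2 / d)^n (d^2)^n = (2 d)^n]. *)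
Lemma lebesgue_eball_le : (nu (eball c r) <= ((2 * d) ^+ n)%:E)%E.
Proof.
have := @integral_ball_le (cst 1) 1 (measurable_cst _).
rewrite (_ : (\int[nu]_(y in eball c r) _)%E = nu (eball c r)); last first.
  rewrite -[LHS]/(\int[nu]_(y in eball c r) (cst 1%:E) y)%E.
  by rewrite integral_cst ?mul1e//; exact: measurable_eball.
under eq_Rintegral do rewrite mulr1.
rewrite Rintegral_ptent -exprMn (_ : 2 / d * d ^+ 2 = 2 * d); last first.
  by field; rewrite gt_eqF.
by apply => y; rewrite ler01 lexx.
Qed.

End ball.

(** * The local L_2 estimate for a block of cubes *)

Section block.
Variables (R : realType) (n : nat) (m : int) (L : nat).
Local Notation nu := (lebesgue_tuple R n).
Local Notation T := (n.-tuple R).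
Local Notation I := {ffun 'I_n -> 'I_(L + L)}.
Local Notation cube i := (dyadic_cube R n m (corner i)).
Variable f : T -> R[i].
Hypothesis intf : cintegrable nu f.
Variable A : {set I}.

Let a (i : I) : R := \int[nu]_(x in cube i) cmod (f x).
Local Notation h := (crestr f (cubes_of m A)).

Let inth : cintegrable nu h.
Proof. by apply: cintegrable_crestr => //; exact: measurable_cubes_of. Qed.

Lemma cell_ge0 i : 0 <= a i.
Proof. by apply: Rintegral_ge0 => x _; exact: cmod_ge0. Qed.

Lemma indic_cubes_of (x : T) : \1_(cubes_of m A) x = \sum_(i in A) \1_(cube i) x :> R.
Proof.
rewrite indicE; case: (boolP (x \in _)); rewrite ?inE.
  case=> i iA xi; rewrite (bigD1 i)//= indicE mem_set// big1 ?addr0// => j /andP[_ ji].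
  rewrite indicE memNset// => xj; move/eqP: ji; apply.
  exact/corner_inj/(dyadic_cube_inj xj xi).
move=> /negP xA; rewrite big1// => i iA; rewrite indicE memNset// => xi.
by apply: xA; rewrite inE; exists i.
Qed.

Lemma Rintegral_cubes_of : \int[nu]_x cmod (h x) = \sum_(i in A) a i.
Proof.
under eq_Rintegral do rewrite crestr_cmod indic_cubes_of mulr_sumr.
rewrite Rintegral_sum.
  by apply: eq_bigr => i _; rewrite Rintegral_indicM.
move=> i; apply: integrable_indicM; first exact: measurable_dyadic_cube.
exact: integrable_cmod.
Qed.

Lemma cmod_fourier_block_le y : cmod (fourier h y) <= 4 * \sum_(i in A) a i.
Proof. by rewrite -Rintegral_cubes_of; exact: cmod_fourier_le. Qed.

Let d : R := 2 / 2 ^ m.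
Let d0 : 0 < d. Proof. by rewrite divr_gt0// exprz_gt0. Qed.

Let part_energy (g : T -> R) (c : T) : nu.-integrable setT (EFin \o g) ->
  (forall x, `|g x| <= cmod (h x)) ->
  \int[nu]_y (ptent d c y * (cos_transform g y ^+ 2 + sin_transform g y ^+ 2)) <=
  (120 * d ^+ 2) ^+ n * \sum_(i in A) a i ^+ 2.
Proof.
move=> ig gh.
have gA x : g x != 0 -> (cubes_of m A) x.
  move=> g0; apply: contrapT => xA; move/eqP: g0; apply; apply/eqP.
  by rewrite -normr_le0 (le_trans (gh x))// crestr_cmod indicE memNset// mulr0.
have gQ x : g x != 0 -> exists i : I, cube i x.
  by move=> /gA[i _ xi]; exists i.
have b0 (i : I) : 0 <= \int[nu]_(x in cube i) `|g x| by exact: Rintegral_ge0.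
(* Schur's test runs over the whole box; cells outside [A] have mass 0 because [g] vanishes
   there. *)
have ba (i : I) : \int[nu]_(x in cube i) `|g x| <= if i \in A then a i else 0.
  have iic : nu.-integrable (cube i) (EFin \o (fun x => `|g x|)).
    by apply: (integrableS measurableT); [exact: measurable_dyadic_cube| |exact: (integrable_norm ig)].
  have iif : nu.-integrable (cube i) (EFin \o (fun x => cmod (f x))).
    by apply: (integrableS measurableT); [exact: measurable_dyadic_cube| |exact: integrable_cmod].
  case: ifPn => iA.
    apply: le_Rintegral => //; first exact: measurable_dyadic_cube.
    move=> x _; rewrite (le_trans (gh x))// crestr_cmod ler_piMr ?cmod_ge0//.
  have -> : \int[nu]_(x in cube i) `|g x| = \int[nu]_(x in cube i) (0 : R).
    apply: eq_Rintegral => x; rewrite inE => xi; apply/eqP; rewrite normr_eq0.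
    apply/negPn/negP => /gA[j jA xj].
    by move: iA; rewrite (corner_inj (dyadic_cube_inj xi xj)) jA.
  by rewrite Rintegral_cst ?mul0r//; exact: measurable_dyadic_cube.
apply: le_trans.
  apply: (@energy_le_cells _ _ _ c g d0 ig _ (fun i : I => cube i)
    (fun i j => lattice_kernel d (corner i) (corner j))) => //.
  - by move=> i; exact: measurable_dyadic_cube.
  - by move=> i j; exact: lattice_kernel_ge0.
  - by move=> i j x x'; exact: ptent_hat_phase_le.
apply: le_trans.
  apply: (@sum_kernel_le _ _ _ _ ((120 * d ^+ 2) ^+ n)) => //.
  - by move=> i j; exact: lattice_kernel_ge0.
  - by move=> i j; exact: lattice_kernelC.
  - exact: sum_lattice_kernel_le.
rewrite ler_wpM2l//; first by rewrite exprn_ge0// mulr_ge0// sqr_ge0.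
rewrite [leRHS]big_mkcond ler_sum// => i _; have := ba i; have := b0 i.
by case: ifPn => _ h1 h2; [rewrite ler_sqr ?nnegrE ?cell_ge0|rewrite (le_anti (introT andP (conj h2 h1))) expr0n].
Qed.

(** The factor [4 = 2 + 2] adds up the real and imaginary parts, and
    [(2 / d) (120 d^2) = 240 d = 480 * 2^-m] for [d = 2 / 2^m]. *)
Lemma fourier_block_L2 (c : T) (r : R) : r <= 2 ^ (- m) ->
  (\int[nu]_(y in eball c r) (cmod (fourier h y) ^+ 2)%:E <=
    (4 * (480 * 2 ^ (- m)) ^+ n * \sum_(i in A) a i ^+ 2)%:E)%E.
Proof.
have lin (x y z : R) : x <= z -> y <= z -> 2 * x + 2 * y <= 4 * z by lra.
move=> rm; have d2 : d / 2 = 2 ^ (- m).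
  by rewrite /d -invr_expz mulrAC divff ?mul1r// pnatr_eq0.
have rd : r <= d / 2 by rewrite d2.
set G : R := \int[nu]_x cmod (h x).
have mF : measurable_fun setT (fun y => cmod (fourier h y) ^+ 2).
  by apply: measurable_funX; exact/measurable_cmod/cmeasurable_fourier.
have kM y : 0 <= cmod (fourier h y) ^+ 2 <= (4 * G) ^+ 2.
  rewrite sqr_ge0/= ler_sqr ?nnegrE ?cmod_ge0//; first exact: cmod_fourier_le.
  by rewrite mulr_ge0// Rintegral_ge0// => x _; exact: cmod_ge0.
apply: le_trans; first exact: (@integral_ball_le _ _ d r c d0 rd _ _ mF kM).
rewrite lee_fin.
pose E (g : T -> R) y := cos_transform g y ^+ 2 + sin_transform g y ^+ 2.
have intE (g : T -> R) : nu.-integrable setT (EFin \o g) ->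
    nu.-integrable setT (EFin \o (fun y => ptent d c y * E g y)).
  move=> ig; pose N := \int[nu]_x `|g x|.
  have mg : measurable_fun setT g by apply/measurable_EFinP; case/integrableP : ig.
  have [mc ms] := (measurable_cos_transform ig, measurable_sin_transform ig).
  apply: (integrable_mul_bounded (M := N ^+ 2 + N ^+ 2) (integrable_ptent d c)).
    by apply: measurable_funD; exact: measurable_funX.
  move=> y; rewrite ger0_norm ?addr_ge0 ?sqr_ge0//.
  have [b1 b2] := (cos_transform_le ig y, sin_transform_le ig y).
  rewrite /E -(real_normK (num_real (cos_transform g y))) -(real_normK (num_real (sin_transform g y))).
  have N0 : 0 <= N by exact: Rintegral_ge0.
  by rewrite lerD// ler_sqr ?nnegrE.
have [ir ii] := inth.
have sE : \int[nu]_y (ptent d c y * cmod (fourier h y) ^+ 2) <=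
   2 * \int[nu]_y (ptent d c y * E (fun x => complex.Re (h x)) y) +
   2 * \int[nu]_y (ptent d c y * E (fun x => complex.Im (h x)) y).
  rewrite -!RintegralZl; [|done|exact: intE|done|exact: intE].
  rewrite -RintegralD; [|done|exact/integrable_mull/intE|exact/integrable_mull/intE].
  have ih : nu.-integrable setT (EFin \o (fun y => ptent d c y * cmod (fourier h y) ^+ 2)).
    apply: (integrable_mul_bounded (M := (4 * G) ^+ 2) (integrable_ptent d c)) => // y.
    by have /andP[k0 ?] := kM y; rewrite ger0_norm.
  apply: le_Rintegral => //.
    have := integrableD measurableT (integrable_mull 2 (intE _ ir)) (integrable_mull 2 (intE _ ii)).
    by congr (_.-integrable _ _); apply/funext => y /=; rewrite EFinD.
  move=> y _; rewrite (mulrCA 2 (ptent d c y)) (mulrCA 2 (ptent d c y)) -mulrDr.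
  rewrite ler_wpM2l ?ptent_ge0//.
  exact: sqr_cmod_fourier_le.
have e1 := part_energy c ir (fun x => Re_le_cmod (h x)).
have e2 := part_energy c ii (fun x => Im_le_cmod (h x)).
apply: (@le_trans _ _ ((2 / d) ^+ n * (4 * ((120 * d ^+ 2) ^+ n * \sum_(i in A) a i ^+ 2)))).
  rewrite ler_wpM2l//; first by rewrite exprn_ge0// divr_ge0// ltW.
  apply: (le_trans sE).
  exact: lin e1 e2.
rewrite mulrCA [leLHS]mulrA -[leLHS]mulrA [X in _ * X <= _]mulrA -exprMn.
have dE (x : R) : 0 < x -> 2 / x * (120 * x ^+ 2) = 480 * (x / 2).
  by move=> x0; field; rewrite gt_eqF.
by rewrite (dE _ d0) d2 mulrA.
Qed.

End block.

(** * Level sets of the cube masses and the logarithm *)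

Section levels.
Variables (R : realType) (I : finType) (a : I -> R) (S P : R) (n J : nat).
Hypotheses (S0 : 0 < S) (P1 : 1 < P) (n1 : (1 <= n)%N).
Hypothesis aS : forall A : {set I}, (0 < #|A|)%N ->
  (1 + ln #|A|%:R) ^+ n.+1 / #|A|%:R `^ P^-1 * \sum_(i in A) a i <= S.

(* Level [j < J] means [S / 2^(j+1) < a i <= S / 2^j]; level [J] collects the rest. *)
Definition level (i : I) : nat := find (fun j => S / 2 ^+ j.+1 < a i) (iota 0 J).

Lemma level_le i : (level i <= J)%N.
Proof. by rewrite -[leqRHS](size_iota 0) find_size. Qed.

Lemma single_le i : a i <= S.
Proof.
have := aS (A := [set i]%SET); rewrite cards1 big_set1 ln1 addr0 expr1n powR1 divr1 mul1r.
by apply.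
Qed.

Lemma le_level i : a i <= S / 2 ^+ level i.
Proof.
case E : (level i) => [|l]; first by rewrite divr1 single_le.
have : (l < level i)%N by rewrite E.
move/(before_find 0%N); rewrite nth_iota; last by rewrite -E level_le.
by rewrite add0n => /negbT; rewrite -leNgt.
Qed.

Lemma level_gt i : (level i < J)%N -> S / 2 ^+ (level i).+1 < a i.
Proof.
move=> lJ; have h : has (fun j => S / 2 ^+ j.+1 < a i) (iota 0 J).
  by rewrite has_find size_iota.
by have := nth_find 0%N h; rewrite nth_iota// add0n.
Qed.

Definition level_set (j : nat) : {set I} := [set i | level i == j]%SET.

Definition level_mass (j : nat) : R := #|level_set j|%:R `^ (1 - P^-1) / 2 ^+ j.

(* If [N ^ (1 - 1/P) <= (3/2)^j] the factor [2^-j] wins; otherwise [ln N >= j / 3]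
   and the logarithmic factor of the hypothesis wins. *)
Lemma level_mass_le j : (j < J)%N -> level_mass j <= (3 / 4) ^+ j + 18 / (1 + j%:R) ^+ 2.
Proof.
move=> jJ; have P0 : 0 < P by exact: lt_trans P1.
have iP1 : P^-1 < 1 by rewrite invf_lt1.
have iP0 : 0 < P^-1 by rewrite invr_gt0.
have r0 : 0 <= 18 / (1 + j%:R) ^+ 2 :> R by rewrite divr_ge0// sqr_ge0.
have l0 : 0 <= (3 / 4) ^+ j :> R by rewrite exprn_ge0// divr_ge0.
have [E0|E0] := posnP #|level_set j|.
  rewrite /level_mass E0 powR0 ?mul0r ?addr_ge0//.
  by rewrite subr_eq0 eq_sym lt_eqF.
have := aS E0; set N : R := #|level_set j|%:R.
have N1 : 1 <= N by rewrite ler1n.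
have N0 : 0 < N by lra.
have lN : 0 <= ln N by rewrite ln_ge0.
have sumA : N * (S / 2 ^+ j.+1) <= \sum_(i in level_set j) a i.
  rewrite /N mulr_natl -sumr_const ler_sum// => i; rewrite inE => /eqP E.
  by have := @level_gt i; rewrite E => /(_ jJ)/ltW.
have c0 : 0 <= (1 + ln N) ^+ n.+1 / N `^ P^-1.
  by rewrite divr_ge0 ?powR_ge0// exprn_ge0// addr_ge0.
move=> /(le_trans (ler_wpM2l c0 sumA)) => h.
have v0 : 0 <= level_mass j by rewrite divr_ge0 ?powR_ge0// exprn_ge0.
(* The [N] cubes of level [j] carry at least [N S / 2^(j+1)]; inserted into the hypothesis and
   divided by [S], this leaves the factor 2. *)
have h1 : (1 + ln N) ^+ n.+1 * level_mass j <= 2.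
  rewrite -(ler_pM2r S0); apply: le_trans (ler_wpM2l (_ : 0 <= 2) h) => //.
  rewrite le_eqVlt; apply/orP; left; apply/eqP.
  rewrite /level_mass -/N powRB; last by rewrite (gt_eqF N0) implybT.
  rewrite powRr1 ?ltW// (exprS 2 j); have := powR_gt0 P^-1 N0.
  have : (0 : R) < 2 ^+ j by rewrite exprn_gt0.
  move: (N `^ _) (2 ^+ j) ((1 + ln N) ^+ n.+1) => x y z y0 x0.
  by field; rewrite !gt_eqF.
(* As [n >= 1], the exponent [n + 1] is at least 2, which yields the summable rate [(1 + j)^-2]. *)
have h2 : (1 + ln N) ^+ 2 * level_mass j <= 2.
  apply: le_trans h1; rewrite ler_wpM2r// ler_weXn2l//; lra.
have [small|large] := lerP (N `^ (1 - P^-1)) ((3 / 2) ^+ j).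
  apply: (@le_trans _ _ ((3 / 4) ^+ j)); last by rewrite lerDl.
  rewrite /level_mass -/N ler_pdivrMr ?exprn_gt0// -exprMn.
  by rewrite (_ : 3 / 4 * 2 = 3 / 2 :> R)//; field.
apply: (@le_trans _ _ (18 / (1 + j%:R) ^+ 2)); last by rewrite lerDr.
(* From [ln (2/3) = ln (1 - 1/3) <= -1/3]. *)
have ln32 : (1 / 3 : R) <= ln (3 / 2).
  have -> : (3 / 2 : R) = (2 / 3)^-1 by rewrite invf_div.
  rewrite lnV ?posrE ?divr_gt0// lerNr.
  have := @le_ln1Dx R (- (1 / 3)); rewrite (_ : 1 + - (1 / 3) = 2 / 3 :> R); last by field.
  by apply; lra.
have lnN : (1 + j%:R) / 3 <= 1 + ln N.
  have q1 : N `^ (1 - P^-1) <= N by rewrite ler1_powR// lerBlDr lerDl ltW.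
  have q2 : ln ((3 / 2) ^+ j) <= ln N.
    rewrite ler_ln ?posrE ?exprn_gt0 ?divr_gt0//.
    exact: le_trans (ltW large) q1.
  move: q2; rewrite lnXn ?divr_gt0// -(mulr_natl (ln _)) => q2.
  have j0 : (0 : R) <= j%:R by [].
  have := ler_wpM2l j0 ln32; lra.
have j1 : 0 < 1 + j%:R :> R by rewrite ltr_pwDl.
rewrite ler_pdivlMr ?exprn_gt0//.
(* Here [18 = 2 * 3^2] arises. *)
have : ((1 + j%:R) / 3) ^+ 2 * level_mass j <= 2.
  have g1 : 0 <= (1 + j%:R) / 3 :> R by rewrite divr_ge0// ltW.
  have g2 : 0 <= 1 + ln N by rewrite addr_ge0.
  by apply: le_trans h2; rewrite ler_wpM2r// ler_sqr ?nnegrE.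
rewrite expr_div_n; lra.
Qed.

Lemma sum_level_mass_le : \sum_(j < J) level_mass j <= 40.
Proof.
(* Both series telescope: [(3/4)^K] is the drop of [4 (3/4)^K], and [18 / (1+x)^2] is at most the
   drop [36 / ((1+x)(2+x))] of [36 / (1+x)]. At [K = 0] the bound is [40 - 4 - 36 = 0]. *)
have h K : (K <= J)%N -> \sum_(j < K) level_mass j <= 40 - 4 * (3 / 4) ^+ K - 36 / (1 + K%:R).
  elim: K => [|K IH] KJ; first by rewrite big_ord0 expr0 addr0 divr1; lra.
  rewrite big_ord_recr/=; apply: le_trans (lerD (IH (ltnW KJ)) (level_mass_le KJ)) _.
  rewrite (exprS (3 / 4)) -[K.+1%:R]natr1; set x : R := K%:R.
  have x0 : 0 <= x by [].
  have : 18 / (1 + x) ^+ 2 <= 36 / (1 + x) - 36 / (1 + (x + 1)).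
    rewrite (_ : _ - _ = 36 / ((1 + x) * (2 + x))); last by field; apply/andP; split; lra.
    rewrite ler_pdivrMr ?exprn_gt0 ?ltr_pwDl// mulrAC ler_pdivlMr; last by rewrite mulr_gt0//; lra.
    nra.
  lra.
apply: (le_trans (h J (leqnn J))).
have : 0 <= 36 / (1 + J%:R) :> R by rewrite divr_ge0.
have : 0 <= 4 * (3 / 4) ^+ J :> R by rewrite mulr_ge0// exprn_ge0// divr_ge0.
lra.
Qed.

End levels.

(** * L_P norms of functions restricted to a set *)

Lemma lee_poweR2r (R : realType) (r : R) (x y : \bar R) : 0 <= r ->
  (0 <= x -> x <= y -> x `^ r <= y `^ r)%E.
Proof.
move=> r0 x0 xy; apply: gt0_ler_poweR => //; rewrite in_itv/= leey andbT//.
exact: le_trans xy.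
Qed.

Section Lnorm_restrict.
Context d (T : measurableType d) (R : realType) (mu : {measure set T -> \bar R}).
Variables (B : set T) (P : R).
Hypotheses (mB : measurable B) (P0 : 0 < P).
Local Notation N F := ('N[mu]_P%:E[(EFin \o F) \_ B])%E.
Implicit Types F G : T -> R.

Lemma Lnorm_restrictE F : (forall x, 0 <= F x) ->
  (N F = (\int[mu]_(x in B) (F x `^ P)%:E) `^ P^-1)%E.
Proof.
move=> F0; rewrite unlock; congr (_ `^ _)%E; rewrite [RHS]integral_mkcond.
apply: eq_integral => x _; rewrite !patchE; case: ifPn => _ /=.
  by rewrite ger0_norm.
by rewrite normr0 powR0// gt_eqF.
Qed.

Lemma measurable_powR_comp F : measurable_fun setT F -> measurable_fun setT (fun x => F x `^ P).
Proof. by move=> mF; exact: (measurableT_comp (measurable_powR P)). Qed.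

Lemma Lnorm_restrict_le F K : 0 <= K -> (forall x, 0 <= F x) ->
  (\int[mu]_(x in B) (F x `^ P)%:E <= (K `^ P)%:E)%E -> (N F <= K%:E)%E.
Proof.
move=> K0 F0 FK; rewrite Lnorm_restrictE//.
have -> : K%:E = ((K `^ P)%:E `^ P^-1)%E.
  by rewrite poweR_EFin -powRrM mulfV ?gt_eqF// powRr1.
apply: lee_poweR2r => //; first by rewrite invr_ge0 ltW.
by apply: integral_ge0 => x _; rewrite lee_fin powR_ge0.
Qed.

Lemma le_Lnorm_restrict F G : measurable_fun setT F -> measurable_fun setT G ->
  (forall x, 0 <= F x <= G x) -> (N F <= N G)%E.
Proof.
move=> mF mG FG; have F0 x : 0 <= F x by have /andP[] := FG x.
have G0 x : 0 <= G x by have /andP[/le_trans] := FG x; apply.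
rewrite !Lnorm_restrictE//.
apply: lee_poweR2r; first by rewrite invr_ge0 ltW.
- by apply: integral_ge0 => x _; rewrite lee_fin powR_ge0.
- apply: ge0_le_integral => //.
  + by move=> x _; rewrite lee_fin powR_ge0.
  + by apply/measurable_EFinP/measurable_funTS; exact: measurable_powR_comp.
  + by apply/measurable_EFinP/measurable_funTS; exact: measurable_powR_comp.
  + move=> x _; rewrite lee_fin ge0_ler_powR ?nnegrE ?(ltW P0)//.
    by have /andP[] := FG x.
Qed.

Lemma Lnorm_restrict_sum (I : Type) (s : seq I) (F : I -> T -> R) : 1 <= P ->
  (forall i, measurable_fun setT (F i)) ->
  (N (fun x => \sum_(i <- s) F i x)%R <= \sum_(i <- s) N (F i))%E.
Proof.
move=> P1 mF; elim: s => [|i s IH].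
  rewrite big_nil (_ : _ \_ _ = cst 0%E) ?Lnorm0// ?eqe ?gt_eqF//.
  by apply/funext => x; rewrite patchE/= big_nil; case: ifPn.
rewrite big_cons; apply: le_trans (leeD2l _ IH).
have -> : (EFin \o (fun x => \sum_(i <- i :: s) F i x)) \_ B =
   EFin \o (F i \_ B \+ (fun x => \sum_(i <- s) F i x) \_ B).
  apply/funext => x /=; rewrite !patchE/= big_cons; case: ifPn => // _.
  by rewrite addr0.
rewrite !restrict_EFin; apply: minkowski_EFin => //.
  by apply/(measurable_restrictT _ _).1 => //; exact/measurable_funTS.
apply/(measurable_restrictT _ _).1 => //; apply/measurable_funTS.
exact: measurable_sum.
Qed.

End Lnorm_restrict.

(** * Interpolation between L_2 and the sup norm on one block *)

Section local_bound.
Variables (R : realType) (n : nat) (m : int).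
Local Notation nu := (lebesgue_tuple R n).
Local Notation T := (n.-tuple R).
Variable f : T -> R[i].
Hypothesis intf : cintegrable nu f.
Variables (c : T) (r P : R).
Hypotheses (rm : r <= 2 ^ (- m)) (P2 : 2 <= P).
Local Notation B := (eball c r).
Local Notation LB F := ('N[nu]_P%:E[(EFin \o F) \_ B])%E.

Let V : R := (480 * 2 ^ (- m)) ^+ n.

Let V0 : 0 <= V.
Proof. by apply: exprn_ge0; rewrite mulr_ge0 ?ler0n ?exprz_ge0 ?ler0n. Qed.

Let P0 : 0 < P. Proof. by apply: lt_le_trans P2. Qed.

(** [|F|^P <= (sup |F|)^(P-2) |F|^2], with [sup |F| <= 4 N M] and the integral of [|F|^2] over [B]
    at most [4 V N M^2]. The powers of [N] combine to [P - 1], those of [M] to [P]. *)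
Lemma block_Lp (L : nat) (A : {set {ffun 'I_n -> 'I_(L + L)}}) (M : R) : 0 <= M ->
  (forall i, i \in A -> \int[nu]_(x in dyadic_cube R n m (corner i)) cmod (f x) <= M) ->
  (LB (fun y => cmod (fourier (crestr f (cubes_of m A)) y)) <=
   (4 * V `^ P^-1 * (M * #|A|%:R `^ (1 - P^-1)))%:E)%E.
Proof.
move=> M0 aM; pose a (i : {ffun 'I_n -> 'I_(L + L)}) := \int[nu]_(x in dyadic_cube R n m (corner i)) cmod (f x).
set h := crestr f _; set N : R := #|A|%:R.
have N0 : 0 <= N by [].
have a0 i : 0 <= a i by apply: Rintegral_ge0 => x _; exact: cmod_ge0.
have s1 : \sum_(i in A) a i <= N * M.
  by rewrite /N mulr_natl -sumr_const ler_sum.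
have s2 : \sum_(i in A) a i ^+ 2 <= N * M ^+ 2.
  by rewrite /N mulr_natl -sumr_const ler_sum// => i iA; rewrite ler_sqr ?nnegrE ?aM.
have inth : cintegrable nu h by apply: cintegrable_crestr => //; exact: measurable_cubes_of.
have mF : measurable_fun setT (fun y => cmod (fourier h y)).
  exact/measurable_cmod/cmeasurable_fourier.
have powP (x : R) : 0 <= x -> x `^ (P - 2) * x ^+ 2 = x `^ P.
  move=> x0; rewrite -(powR_mulrn 2 x0) -powRD ?subrK//.
  by rewrite gt_eqF.
have mB : measurable B by exact: measurable_eball.
apply: Lnorm_restrict_le => //.
- by rewrite !mulr_ge0 ?powR_ge0.
- by move=> x; exact: cmod_ge0.
apply: (@le_trans _ _ (\int[nu]_(y in B) ((4 * (N * M)) `^ (P - 2) * cmod (fourier h y) ^+ 2)%:E)%E).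
  apply: ge0_le_integral => //.
  - by move=> x _; rewrite lee_fin powR_ge0.
  - by apply/measurable_EFinP/measurable_funTS; exact: measurable_powR_comp.
  - apply/measurable_EFinP/measurable_funTS/measurable_funM => //.
    exact: measurable_funX.
  move=> y _; rewrite lee_fin.
  rewrite -powP ?cmod_ge0// ler_wpM2r ?sqr_ge0//.
  rewrite ge0_ler_powR ?nnegrE ?subr_ge0 ?cmod_ge0 ?mulr_ge0//.
  by rewrite (le_trans (cmod_fourier_block_le m intf A y))// ler_wpM2l.
rewrite (eq_integral (fun y => ((4 * (N * M)) `^ (P - 2))%:E * (cmod (fourier h y) ^+ 2)%:E)%E);
  last by move=> y _; rewrite EFinM.
rewrite ge0_integralZl//; last 3 first.
- by apply/measurable_EFinP/measurable_funTS; exact: measurable_funX.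
- by move=> y _; rewrite lee_fin sqr_ge0.
- by rewrite lee_fin powR_ge0.
apply: le_trans (lee_wpmul2l _ (fourier_block_L2 intf A c rm)) _; first by rewrite lee_fin powR_ge0.
rewrite -EFinM lee_fin -/V.
apply: (@le_trans _ _ ((4 * (N * M)) `^ (P - 2) * (4 * V * (N * M ^+ 2)))).
  by rewrite ler_wpM2l ?powR_ge0// ler_wpM2l ?mulr_ge0.
have powN : N `^ (P - 2) * N = N `^ (P - 1).
  rewrite -[X in _ * X](powRr1 N0) -powRD; first by congr (_ `^ _); ring.
  by apply/implyP => /eqP; have := P2; lra.
rewrite !powRM ?mulr_ge0 ?powR_ge0//.
rewrite -[V `^ _ `^ P]powRrM mulVf ?gt_eqF// powRr1//.
rewrite -[N `^ _ `^ P]powRrM mulrBl mul1r mulVf ?gt_eqF// -powN -(powP M)//.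
rewrite (_ : _ * _ = 4 `^ (P - 2) * 4 * (N `^ (P - 2) * N) * (M `^ (P - 2) * M ^+ 2) * V); last by ring.
rewrite (_ : 4 `^ P * V * _ = 4 `^ P * (N `^ (P - 2) * N) * (M `^ (P - 2) * M ^+ 2) * V); last by ring.
rewrite !ler_wpM2r ?mulr_ge0 ?powR_ge0 ?sqr_ge0//.
(* What remains is [4^(P-2) * 4 <= 4^(P-2) * 4^2 = 4^P]. *)
rewrite -(powP 4)// ler_wpM2l ?powR_ge0//; lra.
Qed.

End local_bound.

(** * Summing the levels: the local L_P bound *)

Section local_estimate.
Variables (R : realType) (n : nat) (m : int).
Local Notation nu := (lebesgue_tuple R n).
Local Notation T := (n.-tuple R).
Local Notation box L := (cubes_of m [set: {ffun 'I_n -> 'I_(L + L)}]).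
Variable f : T -> R[i].
Hypothesis intf : cintegrable nu f.

(** Dominated convergence: every point lies in all large boxes, and [|f|] is an integrable
    majorant. *)
Lemma tail_box (e : R) : 0 < e -> exists L, \int[nu]_x cmod (crestr f (~` box L) x) <= e.
Proof.
move=> e0; pose f_ L x := (cmod (f x) * \1_(~` box L) x)%:E.
have mbox L : measurable (~` box L : set T) by apply: measurableC; exact: measurable_cubes_of.
have intc := integrable_cmod intf.
have mc : measurable_fun setT (fun x => cmod (f x)).
  by apply: measurable_cmod; exact: cintegrable_cmeasurable intf.
have [|||||_ _] := @dominated_convergence _ _ _ nu setT measurableT f_ (cst 0%E) (EFin \o (fun x => cmod (f x))).
- by move=> L; apply/measurable_EFinP/measurable_funM.
- exact: measurable_cst.
- apply: aeW => x _; apply: cvg_near_cst.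
  apply: filterS (cubes_ofT_exhaust m x) => L xL.
  by rewrite /f_ indicE memNset ?mulr0// => /(_ xL).
- exact: intc.
- apply: aeW => x L _; rewrite lee_fin ger0_norm ?mulr_ge0 ?cmod_ge0//.
  by rewrite ler_piMr ?cmod_ge0.
rewrite integral0 => /fine_cvgP[_ /cvgrPdist_le/(_ _ e0)[L _ HL]].
exists L; have := HL L (leqnn _); rewrite /= sub0r normrN => /(le_trans (ler_norm _)).
rewrite /Rintegral; congr (fine _ <= _).
by apply: eq_integral => x _; rewrite crestr_cmod.
Qed.

Variables (c : T) (r P S : R).
Hypotheses (rm : r <= 2 ^ (- m)) (P2 : 2 <= P) (S0 : 0 < S) (n1 : (1 <= n)%N).
Hypothesis fS : forall e : {fset n.-tuple int}, e != fset0 ->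
  (((1 + ln #|` e|%:R) ^+ n.+1 / #|` e|%:R `^ P^-1)%:E *
    \int[nu]_(x in \bigcup_(k in [set` e]) dyadic_cube R n m k) (cmod (f x))%:E <= S%:E)%E.
Local Notation B := (eball c r).
Local Notation LB F := ('N[nu]_P%:E[(EFin \o F) \_ B])%E.
Local Notation V := ((480 * 2 ^ (- m)) ^+ n : R).

Let cell_sum L (A : {set {ffun 'I_n -> 'I_(L + L)}}) : (0 < #|A|)%N ->
  (1 + ln #|A|%:R) ^+ n.+1 / #|A|%:R `^ P^-1 *
  \sum_(i in A) \int[nu]_(x in dyadic_cube R n m (corner i)) cmod (f x) <= S.
Proof.
move=> A0; pose e := [fset corner i | i in A]%fset.
have eA : #|` e| = #|A| by rewrite card_imfset//= -?cardE//; exact: corner_inj.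
have e0 : e != fset0 by rewrite -cardfs_gt0 eA.
have := fS e0; rewrite eA.
have -> : \bigcup_(k in [set` e]) dyadic_cube R n m k = cubes_of m A.
  apply/seteqP; split => x /=.
    by case=> k /= /imfsetP[i /= iA ->] xi; exists i.
  by case=> i iA xi; exists (corner i) => //=; apply/imfsetP; exists i.
have mA : measurable (cubes_of m A : set T) by exact: measurable_cubes_of.
have -> : (\int[nu]_(x in cubes_of m A) (cmod (f x))%:E)%E =
    (\sum_(i in A) \int[nu]_(x in dyadic_cube R n m (corner i)) cmod (f x))%:E.
  rewrite -Rintegral_cubes_of//; under eq_Rintegral do rewrite crestr_cmod.
  rewrite Rintegral_indicM /Rintegral fineK//; apply: integrable_fin_num => //.
  by apply: (integrableS measurableT) => //; exact: integrable_cmod.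
by rewrite -EFinM lee_fin.
Qed.

Lemma local_Lp_bound : (LB (fun y => cmod (fourier f y)) <= (161 * V `^ P^-1 * S)%:E)%E.
Proof.
have P0 : 0 < P by exact: lt_le_trans P2.
have P1 : 1 < P by apply: lt_le_trans P2; rewrite ltr1n.
have V0 : 0 <= V by apply: exprn_ge0; rewrite mulr_ge0 ?ler0n ?exprz_ge0 ?ler0n.
(* A piece of integral [S / 8] has a transform of size at most [4 * S / 8 = S / 2]; the tail outside
   the box and the bottom level will be two such pieces. *)
have S8 : 0 < S / 8 by rewrite divr_gt0.
have [L tailL] := tail_box S8.
pose I : finType := {ffun 'I_n -> 'I_(L + L)}.
pose a (i : I) := \int[nu]_(x in dyadic_cube R n m (corner i)) cmod (f x).
(* A cube of the bottom level [J] has mass at most [S / 2^J], so with [2^J >= 8 |I|] all of them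
   together have at most [S / 8]. *)
have [J HJ] : exists J, 8 * #|I|%:R <= 2 ^+ J :> R.
  exists (8 * #|I|)%N; rewrite -natrM -natrX ler_nat ltnW//.
  exact: ltn_expl.
have aS (A : {set I}) : (0 < #|A|)%N ->
    (1 + ln #|A|%:R) ^+ n.+1 / #|A|%:R `^ P^-1 * \sum_(i in A) a i <= S by exact: cell_sum.
pose A j : {set I} := level_set a S J j.
pose h j := crestr f (cubes_of m (A j)).
pose h' := crestr f (~` box L).
have mh j : measurable_fun setT (fun y => cmod (fourier (h j) y)).
  apply/measurable_cmod/cmeasurable_fourier/cintegrable_crestr => //.
  exact: measurable_cubes_of.
have mbox : measurable (~` box L : set T) by apply: measurableC; exact: measurable_cubes_of.
(* The indices up to [J] are the levels and [J + 1] is the complement of the box; together they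
   partition the space. *)
pose X (j : nat) : set T := if (j <= J)%N then cubes_of m (A j) else ~` box L.
have mX j : measurable (X j).
  by rewrite /X; case: ifPn => _ //; exact: measurable_cubes_of.
have XE x : \sum_(j < J.+2) \1_(X j) x = 1 :> R.
  rewrite big_ord_recr/= {2}/X ltnn.
  rewrite (eq_bigr (fun j : 'I_J.+1 => \sum_(i in A j) \1_(dyadic_cube R n m (corner i)) x)); last first.
    by move=> j _; rewrite /X -ltnS ltn_ord indic_cubes_of.
  have -> : \sum_(j < J.+1) \sum_(i in A j) \1_(dyadic_cube R n m (corner i)) x = \1_(box L) x :> R.
    rewrite indic_cubes_of (partition_big (fun i : I => inord (level a S J i) : 'I_J.+1) predT)//=.
    apply: eq_bigr => j _; apply: eq_bigl => i; rewrite !inE -val_eqE/= inordK//.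
    by rewrite ltnS level_le.
  rewrite !indicE; case: (boolP (x \in box L)) => xL.
    by rewrite memNset ?addr0//= => /(_ (set_mem xL)).
  by rewrite mem_set ?add0r//= => /mem_set; exact/negP.
have point y : cmod (fourier f y) <= \sum_(j < J) cmod (fourier (h j) y) + S.
  apply: le_trans (cmod_fourier_split intf y (fun j : 'I_J.+2 => mX j) XE) _.
  rewrite !big_ord_recr/= {2 3}/X leqnn ltnn -addrA; apply: lerD.
    by apply: ler_sum => j _; rewrite /X ltnW.
  rewrite (splitr S); apply: lerD.
    apply: (le_trans (cmod_fourier_block_le m intf (A J) y)).
    have : \sum_(i in A J) a i <= #|I|%:R * (S / 2 ^+ J).
      apply: (@le_trans _ _ (\sum_(i in A J) (S / 2 ^+ J))).
        apply: ler_sum => i; rewrite inE => /eqP <-; exact: (le_level _ aS).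
      rewrite sumr_const -[leLHS]mulr_natl ler_wpM2r ?ler_nat ?max_card//.
      by rewrite divr_ge0 ?exprn_ge0// ltW.
    rewrite mulrA ler_pdivlMr ?exprn_gt0// => h1.
    have : \sum_(i in A J) a i <= S / 8.
      rewrite -(ler_pM2r (_ : 0 < 2 ^+ J)) ?exprn_gt0//; apply: (le_trans h1).
      by have := ler_wpM2l (ltW S8) HJ; lra.
    by rewrite /a => h2; lra.
  apply: (le_trans (cmod_fourier_le (cintegrable_crestr mbox intf) y)).
  by rewrite (le_trans (ler_wpM2l _ tailL))//; lra.
have mfh : measurable_fun setT (fun y => cmod (fourier f y)).
  exact/measurable_cmod/cmeasurable_fourier.
have mB : measurable B by exact: measurable_eball.
(* Index [J] carries the constant [S], which stands for the bottom level and the tail at once. *)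
pose F (j : nat) (y : T) := if (j < J)%N then cmod (fourier (h j) y) else S.
have mF j : measurable_fun setT (F j) by rewrite /F; case: (j < J)%N.
apply: (@le_trans _ _ (LB (fun y => \sum_(j < J.+1) F j y)%R)).
  apply: le_Lnorm_restrict => //; first exact: measurable_sum.
  move=> y; rewrite cmod_ge0/= (le_trans (point y))// big_ord_recr/= {2}/F ltnn lerD2r.
  by apply: ler_sum => j _; rewrite /F ltn_ord.
apply: le_trans.
  exact: (@Lnorm_restrict_sum _ _ _ nu B P mB P0 _ _ (fun j : 'I_J.+1 => F j) (ltW P1) (fun j => mF j)).
rewrite big_ord_recr/=.
have lastE : (LB (F J) <= (V `^ P^-1 * S)%:E)%E.
  apply: (Lnorm_restrict_le P0).
  - by rewrite mulr_ge0 ?powR_ge0 ?ltW.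
  - by move=> y; rewrite /F ltnn ltW.
  rewrite (eq_integral (fun=> (S `^ P)%:E)); last by move=> y _; rewrite /F ltnn.
  rewrite integral_cst// powRM ?powR_ge0 ?(ltW S0)// -powRrM mulVf ?gt_eqF// powRr1// mulrC EFinM.
  rewrite lee_wpmul2l ?lee_fin ?powR_ge0//.
  have d0 : 0 < 2 * 2 ^ (- m) :> R by rewrite mulr_gt0// exprz_gt0.
  have rd : r <= 2 * 2 ^ (- m) / 2 by rewrite mulrAC divff ?mul1r.
  apply: (le_trans (lebesgue_eball_le c d0 rd)); rewrite lee_fin mulrA.
  have w4 : (2 * 2 : R) <= 480 by lra.
  by rewrite lerXn2r ?nnegrE ?mulr_ge0 ?ler0n ?exprz_ge0 ?ler0n ?ler_wpM2r ?exprz_ge0 ?ler0n.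
have blockE (j : 'I_J) : (LB (F j) <= (4 * V `^ P^-1 * S * level_mass a S P J j)%:E)%E.
  have -> : F j = (fun y => cmod (fourier (h j) y)) by apply/funext => y; rewrite /F ltn_ord.
  have -> : 4 * V `^ P^-1 * S * level_mass a S P J j =
    4 * V `^ P^-1 * (S / 2 ^+ j * #|A j|%:R `^ (1 - P^-1)) by rewrite /level_mass -/(A j); ring.
  apply: block_Lp => //; first by rewrite divr_ge0 ?exprn_ge0// ltW.
  by move=> i; rewrite inE => /eqP <-; exact: (le_level _ aS).
apply: (@le_trans _ _ (\sum_(j < J) (4 * V `^ P^-1 * S * level_mass a S P J j)%:E + (V `^ P^-1 * S)%:E)%E).
  apply: leeD => //; apply: lee_sum => j _.
  have := blockE j; congr (Lnorm _ _ _ <= _)%E.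
rewrite sumEFin -EFinD lee_fin -mulr_sumr.
have := sum_level_mass_le J S0 P1 n1 aS.
have VS : 0 <= V `^ P^-1 * S by rewrite mulr_ge0 ?powR_ge0 ?ltW.
move=> /(ler_wpM2l VS); lra.
Qed.

End local_estimate.

(** * The local L_p bound for every positive p *)

Section local_bound_p.
Variables (R : realType) (n : nat).
Local Notation nu := (lebesgue_tuple R n).
Local Notation T := (n.-tuple R).

(* Compare [t] with [S]. *)
Lemma powR_le_sqr (p S t : R) : 0 < p -> p < 2 -> 0 < S -> 0 <= t ->
  t `^ p <= S `^ (p - 2) * t ^+ 2 + S `^ p.
Proof.
move=> p0 p2 S0 t0; have [tS|St] := leP t S.
  rewrite -[leLHS]add0r lerD ?mulr_ge0 ?powR_ge0 ?sqr_ge0//.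
  by rewrite ge0_ler_powR ?nnegrE// ltW.
have t1 : 0 < t by exact: lt_trans St.
rewrite -[leLHS]addr0 lerD ?powR_ge0//.
have -> : t `^ p = t `^ (p - 2) * t ^+ 2.
  by rewrite -(powR_mulrn 2 t0) -powRD ?subrK// (gt_eqF p0).
rewrite ler_wpM2r ?sqr_ge0// -(opprB 2 p) !powRN lef_pV2 ?posrE ?powR_gt0//.
by rewrite ge0_ler_powR ?nnegrE ?subr_ge0 ?ltW.
Qed.

(* [161 = 4 * 40 + 1]: 40 bounds the sum of the [level_mass], 4 is the constant of
   [block_Lp], and the 1 accounts for the cubes of level [J] and the tail of [f]. *)
Definition local_constant (p : R) : R :=
  let k : R := 161 in let w : R := 480 in (k + (k ^+ 2 + 1) `^ p^-1) * (w ^+ n) `^ p^-1.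

Lemma local_constant_gt0 p : 0 < local_constant p.
Proof.
rewrite /local_constant; have : (0 : R) < 161 by rewrite ltr0n.
have : (0 : R) < 480 by rewrite ltr0n.
move: (161 : R) (480 : R) => k w w0 k0.
by rewrite mulr_gt0 ?powR_gt0 ?exprn_gt0// ltr_pwDl ?powR_ge0.
Qed.

Variables (m : int) (f : T -> R[i]).
Hypothesis intf : cintegrable nu f.
Variables (c : T) (r p S : R).
Hypotheses (rm : r <= 2 ^ (- m)) (p0 : 0 < p) (S0 : 0 < S) (n1 : (1 <= n)%N).
Hypothesis fS : forall e : {fset n.-tuple int}, e != fset0 ->
  (((1 + ln #|` e|%:R) ^+ n.+1 / #|` e|%:R `^ (p^-1 - Num.max 0 (p^-1 - 2^-1)))%:E *
    \int[nu]_(x in \bigcup_(k in [set` e]) dyadic_cube R n m k) (cmod (f x))%:E <= S%:E)%E.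

(** For [p < 2] the exponent of the cardinality is [1/2], which is the hypothesis of the L_2
    estimate. Integrating [powR_le_sqr] over the ball gives two terms of the same order [V S^p].
    This branch uses no triangle inequality in L_p, so it covers [p < 1]. *)
Lemma local_bound :
  (cLnorm nu p (eball c r) (fourier f) <=
    (local_constant p * ((2 ^ (- m)) ^+ n) `^ p^-1 * S)%:E)%E.
Proof.
have z0 : 0 <= (2 : R) ^ (- m) by exact: exprz_ge0.
have local p' : 2 <= p' -> _ := fun p2 => local_Lp_bound intf c rm p2 S0 n1.
have w4 : (2 * 2 : R) <= 480 by lra.
rewrite /local_constant; have : (0 : R) < 161 by rewrite ltr0n.
have : (0 : R) < 480 by rewrite ltr0n.
move: (161 : R) (480 : R) local w4 => k w local w4 w0' k0'.
have w0 : 0 <= w by exact: ltW.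
have k0 : 0 <= k by exact: ltW.
have VE : ((w * 2 ^ (- m)) ^+ n) `^ p^-1 =
    (w ^+ n) `^ p^-1 * ((2 ^ (- m)) ^+ n) `^ p^-1 :> R.
  by rewrite exprMn powRM ?exprn_ge0.
set V := (w * 2 ^ (- m)) ^+ n in VE.
have V0 : 0 <= V by rewrite exprn_ge0// mulr_ge0.
have -> : (k + (k ^+ 2 + 1) `^ p^-1) * (w ^+ n) `^ p^-1 * ((2 ^ (- m)) ^+ n) `^ p^-1 * S =
    (k + (k ^+ 2 + 1) `^ p^-1) * V `^ p^-1 * S by rewrite VE; ring.
have mB : measurable (eball c r) by exact: measurable_eball.
have mF : measurable_fun setT (fun y => cmod (fourier f y)).
  exact/measurable_cmod/cmeasurable_fourier.
have VS : 0 <= V `^ p^-1 * S by rewrite mulr_ge0 ?powR_ge0 ?ltW.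
have [p2|p2] := leP 2 p.
  have iE : p^-1 - Num.max 0 (p^-1 - 2^-1) = p^-1.
    by rewrite max_l ?subr0// subr_le0 lef_pV2 ?posrE.
  have fS' := fS; rewrite iE in fS'.
  apply: (le_trans (local _ p2 fS')); rewrite lee_fin -/V.
  by rewrite -!mulrA ler_wpM2r// lerDl powR_ge0.
have iE : p^-1 - Num.max 0 (p^-1 - 2^-1) = 2^-1.
  by rewrite max_r ?subKr// subr_ge0 lef_pV2 ?posrE// ltW.
have fS' := fS; rewrite iE in fS'.
have := local _ (lexx 2) fS'; rewrite -/V => L2.
have F0 y : 0 <= cmod (fourier f y) by exact: cmod_ge0.
have h2 : (\int[nu]_(y in eball c r) (cmod (fourier f y) ^+ 2)%:E <= (k ^+ 2 * V * S ^+ 2)%:E)%E.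
  rewrite Lnorm_restrictE// in L2.
  set X := (\int[nu]_(x in _) _)%E in L2.
  have X0 : (0 <= X)%E by apply: integral_ge0 => y _; rewrite lee_fin powR_ge0.
  have : (X <= (k ^+ 2 * V * S ^+ 2)%:E)%E.
    have := lee_poweR2r (ler0n _ 2) (poweR_ge0 _ _) L2.
    rewrite -poweRrM mulVf ?pnatr_eq0// poweRe1// => /le_trans; apply.
    rewrite poweR_EFin lee_fin powR_mulrn ?mulr_ge0 ?powR_ge0 ?(ltW S0)//.
    by rewrite !exprMn -(powR_mulrn 2 (powR_ge0 _ _)) -powRrM mulVf ?pnatr_eq0// powRr1.
  rewrite /X; congr (_ <= _)%E; apply: eq_integral => y _.
  by rewrite powR_mulrn.
apply: Lnorm_restrict_le => //.
  by rewrite !mulr_ge0 ?addr_ge0 ?powR_ge0 ?ltW.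
have mF2 : measurable_fun (eball c r) (fun y => (cmod (fourier f y) ^+ 2)%:E).
  by apply/measurable_EFinP/measurable_funTS; exact: measurable_funX.
apply: (@le_trans _ _ (\int[nu]_(y in eball c r)
    ((S `^ (p - 2))%:E * (cmod (fourier f y) ^+ 2)%:E + (S `^ p)%:E))%E).
  apply: ge0_le_integral => //.
  - by move=> y _; rewrite lee_fin powR_ge0.
  - by apply/measurable_EFinP/measurable_funTS; exact: measurable_powR_comp.
  - by apply: emeasurable_funD => //; apply: emeasurable_funM.
  - by move=> y _; rewrite -EFinM -EFinD lee_fin powR_le_sqr.
rewrite ge0_integralD//=; last 3 first.
- by move=> y _; rewrite -EFinM lee_fin mulr_ge0 ?powR_ge0 ?sqr_ge0.
- exact: emeasurable_funM.
- by move=> y _; rewrite lee_fin powR_ge0.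
rewrite ge0_integralZl//; [|by move=> y _; rewrite lee_fin sqr_ge0|by rewrite lee_fin powR_ge0].
rewrite integral_cst//.
have d0 : 0 < 2 * 2 ^ (- m) :> R by rewrite mulr_gt0// exprz_gt0.
have rd : r <= 2 * 2 ^ (- m) / 2 by rewrite mulrAC divff ?mul1r.
have BV : (nu (eball c r) <= V%:E)%E.
  apply: (le_trans (lebesgue_eball_le c d0 rd)); rewrite lee_fin mulrA.
  by rewrite lerXn2r ?nnegrE ?mulr_ge0 // ler_wpM2r.
apply: (@le_trans _ _ ((S `^ (p - 2))%:E * (k ^+ 2 * V * S ^+ 2)%:E + (S `^ p)%:E * V%:E)%E).
  by apply: leeD; apply: lee_wpmul2l; rewrite ?lee_fin ?powR_ge0.
rewrite -!EFinM -EFinD lee_fin.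
have -> : S `^ (p - 2) * (k ^+ 2 * V * S ^+ 2) + S `^ p * V = (k ^+ 2 + 1) * V * S `^ p.
  have -> : S `^ p = S `^ (p - 2) * S ^+ 2.
    by rewrite -(powR_mulrn 2 (ltW S0)) -powRD ?subrK// (gt_eqF p0).
  by ring.
have k1 : 0 <= k ^+ 2 + 1 by rewrite addr_ge0 ?sqr_ge0.
have e1 : (k ^+ 2 + 1) * V * S `^ p = ((k ^+ 2 + 1) `^ p^-1 * V `^ p^-1 * S) `^ p.
  rewrite !powRM ?mulr_ge0 ?powR_ge0 ?(ltW S0)//.
  by rewrite -!powRrM !mulVf ?gt_eqF// !powRr1.
rewrite e1 ge0_ler_powR ?nnegrE ?mulr_ge0 ?addr_ge0 ?powR_ge0 ?(ltW S0) ?(ltW p0)//.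
by rewrite -!mulrA ler_wpM2r// lerDr.
Qed.

End local_bound_p.

(** * From the local bound to one dyadic scale *)

Lemma dyadic_scale (R : realType) (r : R) : 0 < r ->
  exists m : int, 2 ^ (- (m + 1)) < r <= 2 ^ (- m).
Proof.
move=> r0; have l2 : 0 < ln 2 :> R by rewrite ln_gt0// ltr1n.
have lnz (z : int) : ln (2 ^ z : R) = z%:~R * ln 2 by rewrite -powR_intmul// ln_powR.
pose k := Num.floor (- (ln r / ln 2)); exists k.
have /andP[k1 k2] := floor_itv (- (ln r / ln 2)); rewrite -/k in k1 k2.
rewrite -ltr_ln ?posrE ?exprz_gt0// -ler_ln ?posrE ?exprz_gt0// !lnz.
rewrite -ltr_pdivlMr// -ler_pdivrMr// !mulrNz.
by apply/andP; split; [rewrite ltrNl|rewrite lerNr].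
Qed.

Section scale_bound.
Variables (R : realType) (n : nat) (p c : R) (u : R -> R).
Local Notation nu := (lebesgue_tuple R n).
Local Notation T := (n.-tuple R).
Hypotheses (n1 : (1 <= n)%N) (p0 : 0 < p) (c0 : 0 < c).
Hypothesis u_ge0 : forall r, 0 < r -> 0 <= u r.
Hypothesis uc : forall r s, 0 < r -> r <= s <= 2 * r -> u r <= c * u s /\ u s <= c * u r.
Variable f : T -> R[i].
Hypothesis intf : cintegrable nu f.

Local Notation coef e := ((1 + ln #|` e|%:R) ^+ n.+1
  / #|` e|%:R `^ (p^-1 - Num.max 0 (p^-1 - 2^-1)) : R).

Let coef_ge0 (e : {fset n.-tuple int}) : e != fset0 -> 0 <= coef e.
Proof.
move=> e0; rewrite divr_ge0 ?powR_ge0// exprn_ge0// addr_ge0// ln_ge0//.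
by rewrite ler1n cardfs_gt0.
Qed.

Let weight m := u (2 ^ (- m)) / (2 ^ (m * n%:Z)) `^ p^-1.

Let weight_ge0 m : 0 <= weight m.
Proof. by rewrite divr_ge0 ?powR_ge0// u_ge0// exprz_gt0. Qed.

Let mass (m : int) (e : {fset n.-tuple int}) : \bar R :=
  (\int[nu]_(x in \bigcup_(k in [set` e]) dyadic_cube R n m k) (cmod (f x))%:E)%E.

Let mass_ge0 m e : (0 <= mass m e)%E.
Proof. by apply: integral_ge0 => x _; rewrite lee_fin cmod_ge0. Qed.

Lemma le_dyadic_term m (e : {fset n.-tuple int}) : e != fset0 ->
  ((coef e * weight m)%:E * mass m e <= dyadic_term p u f m)%E.
Proof. by move=> e0; apply: ereal_sup_ubound; exists e. Qed.

Lemma dyadic_term_ge0 m : (0 <= dyadic_term p u f m)%E.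
Proof.
have e0 : [fset [tuple (0 : int) | i < n]]%fset != fset0 by rewrite -cardfs_gt0 cardfs1.
apply: le_trans (le_dyadic_term m e0); rewrite mule_ge0// lee_fin mulr_ge0//.
exact: coef_ge0.
Qed.

Lemma scale_bound m r : 2 ^ (- (m + 1)) < r <= 2 ^ (- m) ->
  ((u r)%:E * ereal_sup [set cLnorm nu p (eball x r) (fourier f) | x in [set: T]] <=
    (c * local_constant n p)%:E * dyadic_term p u f m)%E.
Proof.
move=> /andP[r1 r2]; have z0 (k : int) : 0 < 2 ^ k :> R by exact: exprz_gt0.
have r0 : 0 < r by apply: lt_trans r1.
have K0 := local_constant_gt0 n p; set K := local_constant n p in K0 *.
have cK0 : 0 < c * K by rewrite mulr_gt0.
have D0 := dyadic_term_ge0 m.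
(* Doubling applies because [r <= 2^-m < 2 r]. *)
have uru : u r <= c * u (2 ^ (- m)).
  have [] := uc r0 (s := 2 ^ (- m)); last by [].
  rewrite r2/=; have -> : 2 ^ (- m) = 2 * 2 ^ (- (m + 1)) :> R.
    by rewrite opprD expfzDr// exprN1 mulrC divfK.
  by rewrite ler_pM2l// ltW.
(* For [u r = 0] the left side vanishes; otherwise [u (2^-m)] is positive too, and [weight m] may be
   divided by. *)
have [ur0|ur0] := eqVneq (u r) 0.
  by rewrite ur0 mul0e mule_ge0// lee_fin ltW.
have urp : 0 < u r by rewrite lt_neqAle eq_sym ur0 u_ge0.
have u2p : 0 < u (2 ^ (- m)) by rewrite -(pmulr_rgt0 _ c0); exact: lt_le_trans uru.
pose W : R := (2 ^ (m * n%:Z)) `^ p^-1.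
have W0 : 0 < W by rewrite powR_gt0.
have WE : ((2 ^ (- m)) ^+ n) `^ p^-1 = W^-1.
  have W0' : W != 0 by rewrite gt_eqF.
  apply: (mulIf W0'); rewrite mulVf// -powRM ?exprn_ge0 ?ltW//.
  rewrite -exprz_exp -exprnP -exprMn -expfzDr ?addNr ?expr0z ?expr1n ?powR1//.
have w0 : 0 < weight m by rewrite divr_gt0.
have [Dy|Dy] := eqVneq (dyadic_term p u f m) +oo%E.
  by rewrite Dy gt0_muley ?leey// lte_fin.
have Dfin : dyadic_term p u f m \is a fin_num by rewrite ge0_fin_numE// ltey.
rewrite muleC -lee_pdivlMr//.
apply: ge_ereal_sup => _ [x _ <-].
(* The local bound asks for [S > 0], while the dyadic term may be 0; hence the margin [e]. *)
rewrite lee_pdivlMr//; apply/lee_addgt0Pr => e e0.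
pose D := fine (dyadic_term p u f m); have DE : dyadic_term p u f m = D%:E by rewrite fineK.
have Dge : 0 <= D by rewrite fine_ge0.
(* The margin is divided by [c * K] so that it comes back as exactly [e]. *)
pose S := (D + e / (c * K)) / weight m.
have S0 : 0 < S by rewrite divr_gt0// ltr_wpDl// divr_gt0.
have fS (e' : {fset n.-tuple int}) : e' != fset0 -> ((coef e')%:E * mass m e' <= S%:E)%E.
  move=> e'0; rewrite /S [leRHS]EFinM lee_pdivlMr//.
  apply: (@le_trans _ _ D%:E); last by rewrite lee_fin lerDl divr_ge0// ltW.
  by rewrite -DE muleAC -EFinM; exact: le_dyadic_term.
have := local_bound intf x r2 p0 S0 n1 fS; rewrite WE -/K => LB.
apply: le_trans (lee_wpmul2r _ LB) _; first by rewrite lee_fin ltW.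
rewrite DE -!EFinM -EFinD lee_fin.
apply: (@le_trans _ _ (K / W * S * (c * u (2 ^ (- m))))).
  by rewrite ler_wpM2l// ltW// mulr_gt0// divr_gt0.
have cancel_weight (k w v d : R) : 0 < k -> 0 < w -> 0 < v ->
    k / w * ((d + e / (c * k)) / (v / w)) * (c * v) = c * k * d + e.
  by move=> k0 w0' v0; field; rewrite !gt_eqF.
by rewrite /S /weight -/W cancel_weight.
Qed.

End scale_bound.

(* No measurability is needed: the integral of a nonnegative function is defined
   as a supremum over the simple functions below it. *)
Lemma ge0_le_integralT d (T : measurableType d) (R : realType)
    (mu : {measure set T -> \bar R}) (f g : T -> \bar R) :
  (forall x, 0 <= f x)%E -> (forall x, f x <= g x)%E ->
  (\int[mu]_x f x <= \int[mu]_x g x)%E.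
Proof.
move=> f0 fg; have g0 x : (0 <= g x)%E by exact: le_trans (fg x).
rewrite !ge0_integralTE//; apply: le_ereal_sup => _ [h hf <-].
by exists h => //= x; exact: le_trans (fg x).
Qed.

(** * Integration over dyadic shells *)

Section shells.
Variable R : realType.
Local Notation leb := (@lebesgue_measure R).
Local Open Scope ereal_scope.

Let shell (m : int) : set R := [set` `]2%R ^ (- (m + 1))%R, (2%R ^ (- m)%R)%R]].

Let measure_shell m : leb (shell m) = (2%R ^ (- (m + 1)))%R%:E.
Proof.
rewrite lebesgue_measure_itv/= lte_fin.
have e : (2 ^ (- m) = 2 * 2 ^ (- (m + 1)) :> R)%R.
  by rewrite opprD expfzDr// exprN1 mulrC divfK.
have e0 : (0 < 2 ^ (- (m + 1)) :> R)%R by rewrite exprz_gt0.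
rewrite e ltr_pMl// ltr1n/= -EFinB; congr _%:E.
by rewrite mulr_natl mulr2n addrK.
Qed.

(** The factor [2^(m+1)] is the bound of [1/r] on the shell, from the measure [dr/r]; the length
    [2^-(m+1)] of the shell cancels it. *)
Lemma integral_shells_le (F : R -> \bar R) (t : int -> \bar R) :
  (forall r, (0 < r)%R -> 0 <= F r) -> (forall m, 0 <= t m) ->
  (forall m r, (2 ^ (- (m + 1)) < r <= 2 ^ (- m))%R -> F r <= t m * (2 ^ (m + 1))%R%:E) ->
  \int[leb]_(r in `]0%R, +oo[) F r <= \esum_(m in [set: int]) t m.
Proof.
move=> F0 t0 Ft.
(* Integral and sum are exchanged for series over the naturals, so the scales are enumerated through
   [pickle]; a number coding no integer contributes 0. *)
pose code (m : int) : nat := choice.pickle m.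
have codeK m : pickle_inv (code m) = Some m by exact: pickleK_inv.
pose g (k : nat) (r : R) : \bar R :=
  if pickle_inv k is Some m then (t m * (2 ^ (m + 1))%R%:E) * (\1_(shell m) r)%:E else 0.
pose b (k : nat) : \bar R := if pickle_inv k is Some m then t m else 0.
have c0 m : 0 <= t m * (2 ^ (m + 1))%R%:E by rewrite mule_ge0// lee_fin ltW// exprz_gt0.
have g0 k r : 0 <= g k r.
  by rewrite /g; case: pickle_inv => // m; rewrite mule_ge0// lee_fin.
have b0 k : 0 <= b k by rewrite /b; case: pickle_inv.
have ms m : measurable (shell m) by exact: measurable_itv.
have mg k : measurable_fun setT (g k).
  rewrite /g; case: pickle_inv => [m|]; last exact: measurable_cst.
  apply: emeasurable_funM; first exact: measurable_cst.
  by apply/measurable_EFinP; exact: measurable_indic.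
rewrite integral_mkcond.
apply: (@le_trans _ _ (\int[leb]_r (\sum_(k <oo) g k r))).
  apply: ge0_le_integralT => r; rewrite patchE; case: ifPn => //.
    by rewrite inE/= in_itv/= andbT; exact: F0.
    rewrite inE/= in_itv/= andbT => r0.
    have [m rm] := dyadic_scale r0.
    have h1 : F r <= g (code m) r.
      rewrite /g codeK indicE mem_set ?mule1; first exact: Ft.
      by rewrite /shell/= in_itv.
    apply: (le_trans h1); apply: le_trans (nneseries_lim_ge (code m).+1 _) => //.
    by rewrite big_nat_recr//= leeDr// sume_ge0.
  by move=> _; apply: nneseries_ge0.
rewrite integral_nneseries//.
have gb k : \int[leb]_r g k r = b k.
  rewrite /g /b; case: pickle_inv => [m|]; last exact: integral0.
  have mi : measurable_fun [set: R] (fun r => (\1_(shell m) r : R)%:E).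
    by apply/measurable_EFinP; exact: measurable_indic.
  rewrite ge0_integralZl//.
  have -> : \int[leb]_r (\1_(shell m) r : R)%:E = (2 ^ (- (m + 1)))%R%:E.
    have h := @integral_indic _ _ R leb setT measurableT _ (ms m).
    by rewrite h -measure_shell; congr (leb _); exact: setIT.
  by rewrite -muleA -EFinM -expfzDr// subrr expr0z mule1.
under eq_eseriesr do rewrite gb.
rewrite nneseries_esumT//.
have -> : \esum_(m in [set: int]) t m = \esum_(k in range code) b k.
  have codeI : set_inj [set: int] code by move=> m m' _ _; exact: (pcan_inj codeK).
  rewrite (esum_image _ _ _ codeI).
  by apply: eq_esum => m _; rewrite /b (codeK m).
rewrite [leRHS]esum_mkcond; apply: le_esum => k _.
case: ifPn => // kN; rewrite /b.
case E : (pickle_inv k) => [m|//]; move/negP: kN; case; apply/mem_set.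
by exists m => //; have := @pickle_invK int k; rewrite /code E.
Qed.

End shells.

Lemma esum_mull_le (R : realType) (I : choiceType) (D : set I) (c : \bar R)
    (a : I -> \bar R) : (0 <= c)%E -> (forall i, 0 <= a i)%E ->
  (\esum_(i in D) (c * a i) <= c * \esum_(i in D) a i)%E.
Proof.
move=> c0 a0; apply: ge_ereal_sup => _ [F FD <-].
rewrite -ge0_mule_fsumr//; apply: lee_wpmul2l => //.
by apply: esum_ge; exists F.
Qed.

(** The transform of an integrable function is bounded, and balls have finite measure. *)
Lemma cLnorm_fourier_lty (R : realType) (n : nat) (p : R) (f : n.-tuple R -> R[i]) x r :
  0 < p -> cintegrable (lebesgue_tuple R n) f ->
  (cLnorm (lebesgue_tuple R n) p (eball x r) (fourier f) < +oo)%E.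
Proof.
move=> p0 intf.
pose M : R := 4 * \int[lebesgue_tuple R n]_y cmod (f y).
have FM y : cmod (fourier f y) <= M by exact: cmod_fourier_le.
have F0 y : 0 <= cmod (fourier f y) by exact: cmod_ge0.
have M0 : 0 <= M by exact: le_trans (FM [tuple 0 | i < n]).
(* The radius is an arbitrary real here, so [d] is built from its absolute value to be positive. *)
pose d : R := 2 * (1 + `|r|); have d0 : 0 < d by rewrite mulr_gt0// ltr_pwDl.
have rd : r <= d / 2 by rewrite /d mulrAC divff ?pnatr_eq0// mul1r (le_trans (ler_norm r))// lerDr.
pose V : R := (2 * d) ^+ n; have V0 : 0 <= V by rewrite exprn_ge0// mulr_ge0// ltW.
have mB : measurable (eball x r) by exact: measurable_eball.
apply: (@le_lt_trans _ _ (M * V `^ p^-1)%:E); last exact: ltry.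
apply: Lnorm_restrict_le => //; first by rewrite mulr_ge0// powR_ge0.
apply: (@le_trans _ _ (\int[lebesgue_tuple R n]_(y in eball x r) (M `^ p)%:E)%E).
  apply: ge0_le_integral => //.
  - by move=> y _; rewrite lee_fin powR_ge0.
  - apply/measurable_EFinP/measurable_funTS; apply: measurable_powR_comp.
    exact/measurable_cmod/cmeasurable_fourier.
  - by move=> y _; rewrite lee_fin ge0_ler_powR ?nnegrE// ltW.
rewrite integral_cst// powRM ?powR_ge0// -powRrM mulVf ?gt_eqF// powRr1// EFinM.
by apply: lee_wpmul2l; [rewrite lee_fin powR_ge0|exact: lebesgue_eball_le].
Qed.

(** * The Morrey norm and the conclusion *)

Section morrey_bound.
Variables (R : realType) (n : nat) (p C : R) (q : \bar R) (u : R -> R).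
Local Notation nu := (lebesgue_tuple R n).
Variable f : n.-tuple R -> R[i].
Hypotheses (C0 : 0 < C) (q0 : (0 < q)%E).
Hypothesis u_ge0 : forall r, 0 < r -> 0 <= u r.
Hypothesis scale : forall m r, 2 ^ (- (m + 1)) < r <= 2 ^ (- m) ->
  ((u r)%:E * ereal_sup [set cLnorm nu p (eball x r) (fourier f) | x in [set: n.-tuple R]] <=
    C%:E * dyadic_term p u f m)%E.

Lemma morrey_norm_le : (morrey_norm p q u (fourier f) <= C%:E * dyadic_norm p q u f)%E.
Proof.
have D0 m : (0 <= dyadic_term p u f m)%E by exact: dyadic_term_ge0.
pose G r : \bar R := ((u r)%:E *
  ereal_sup [set cLnorm nu p (eball x r) (fourier f) | x in [set: n.-tuple R]])%E.
have G0 r : 0 < r -> (0 <= G r)%E.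
  move=> r0; rewrite mule_ge0 ?lee_fin ?u_ge0//.
  apply: (@le_trans _ _ (cLnorm nu p (eball [tuple 0 | i < n] r) (fourier f))).
    exact: Lnorm_ge0.
  by apply: ereal_sup_ubound; exists [tuple 0 | i < n].
case: q q0 => [q'|_|//]; last first.
  apply: ge_ereal_sup => _ [r r01 <-]; have r0 : 0 < r by move: r01; rewrite /= in_itv/= andbT.
  have [m rm] := dyadic_scale r0; apply: (le_trans (scale rm)).
  by apply: lee_wpmul2l; [rewrite lee_fin ltW|apply: ereal_sup_ubound; exists m].
rewrite lte_fin => q'0; rewrite /morrey_norm /dyadic_norm.
have C'0 : (0 <= C%:E)%E by rewrite lee_fin ltW.
have S0 : (0 <= \esum_(m in [set: int]) dyadic_term p u f m `^ q')%E.
  by apply: esum_ge0 => m _; exact: poweR_ge0.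
(* Writing [C] as a power moves it under the exponent [1/q'], so that only the inner integral and
   sum remain to be compared. *)
have -> : C%:E = ((C%:E `^ q') `^ q'^-1)%E.
  by rewrite -poweRrM mulfV ?gt_eqF// poweRe1.
rewrite -poweRM ?poweR_ge0//; apply: lee_poweR2r; first by rewrite invr_ge0 ltW.
  apply: integral_ge0 => r /=; rewrite in_itv/= andbT => r0.
  by rewrite mule_ge0 ?poweR_ge0// lee_fin invr_ge0 ltW.
apply: (@le_trans _ _ (\esum_(m in [set: int]) (C%:E `^ q' * dyadic_term p u f m `^ q'))%E).
  apply: (@integral_shells_le _ (fun r => G r `^ q' * (r^-1)%:E)%E) => [r r0|m|m r rm].
  - by rewrite mule_ge0 ?poweR_ge0// lee_fin invr_ge0 ltW.
  - by rewrite mule_ge0 ?poweR_ge0.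
  - have /andP[r1 _] := rm; have z0 : 0 < 2 ^ (- (m + 1)) :> R by exact: exprz_gt0.
    have r0 : 0 < r by apply: lt_trans r1.
    apply: lee_pmul; rewrite ?poweR_ge0 ?lee_fin ?invr_ge0 ?(ltW r0)//.
      by rewrite -poweRM//; apply: lee_poweR2r; [exact: ltW|exact: G0|exact: scale].
    by rewrite -(invrK (2 ^ (m + 1))) invr_expz lef_pV2 ?posrE// ltW.
by apply: esum_mull_le => [|m]; exact: poweR_ge0.
Qed.

End morrey_bound.

Theorem theorem4p9 (R : realType) (n : nat) (p : R) (q : \bar R) (u : R -> R)
    (n_ge1 : (1 <= n)%N) (p_gt0 : 0 < p) (q_gt0 : (0 < q)%E)
    (u_Xi : Xi n%:R p q u) (u_doubling : doubling_weight u)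
    (u_Xi2 : p < 2 ->
      Xi n%:R 2 q (fun r => r `^ (n%:R / p - n%:R / 2) * u r)) :
  exists2 C : R, 0 < C &
    forall f : n.-tuple R -> R[i],
      cintegrable (lebesgue_tuple R n) f ->
      (dyadic_norm p q u f < +oo)%E ->
      morrey_space p q u (fourier f) /\
      (morrey_norm p q u (fourier f) <= C%:E * dyadic_norm p q u f)%E.
Proof.
have [c c0 uc] := u_doubling; have [_ u_ge0 _] := u_Xi.
have C0 : 0 < c * local_constant n p by rewrite mulr_gt0// local_constant_gt0.
exists (c * local_constant n p) => // f intf f_fin.
have le : (morrey_norm p q u (fourier f) <=
    (c * local_constant n p)%:E * dyadic_norm p q u f)%E.
  apply: morrey_norm_le => // m r rm.
  exact: scale_bound.
split=> //; split; first exact: cmeasurable_fourier.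
- by move=> x r; exact: cLnorm_fourier_lty.
- apply: (le_lt_trans le); case: (dyadic_norm p q u f) f_fin => [a _|//|_].
    by rewrite -EFinM ltry.
  by rewrite gt0_muleNy ?ltNyr ?lte_fin.
Qed.
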